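(* There is an ordered continuum $\Lambda$ such that, for every sequence $\vec{p}$ of integers greater than $1$, $S(\Lambda,\vec{p})$ is a nonmetric (i.e. nonmetrizable) homogeneous indecomposable circle-like continuum.
   Context: A continuum is a compact connected (Hausdorff) space, not necessarily metrizable. A continuum is indecomposable if it is not the union of two proper subcontinua. A continuum $S$ is circle-like if for each open cover $\mathcal{U}$ of $S$ there is a finite open cover $\{U_1,\dots,U_t\}$ refining $\mathcal{U}$ that forms a circular chain, i.e. $U_i\cap U_j\neq\emptyset$ if and only if $|i-j|\le 1 \pmod t$ (that is, $i-j\equiv 0$ or $\pm1 \pmod t$). A space $S$ is homogeneous if for any two points $x,y\in S$ there is a homeomorphism $h:S\to S$ with $h(x)=y$. An ordered continuum is a nondegenerate compact connected space $\Lambda$ which has a linear order and whose topology is the order topology; $\partial\Lambda$ is the set consisting of its first and last points. For $n\ge 1$, $\Lambda^{(n)}=\Lambda_1\vee\dots\vee\Lambda_n$ denotes $n$ copies of $\Lambda$ laid end to end (the last point of $\Lambda_i$ is identified with the first point of $\Lambda_{i+1}$, orders preserved), and $\Sigma^{(n)}=\Lambda^{(n)}/\partial\Lambda^{(n)}$ is the ''circle'' obtained by identifying the first and last points of $\Lambda^{(n)}$; $\Sigma=\Sigma^{(1)}$. The identified endpoints of the copies of $\Lambda$ in $\Sigma^{(n)}$ are labeled in cyclic order $\infty_0,\dots,\infty_{n-1}$, and for $x\in\Lambda\setminus\partial\Lambda$, $\infty_i+x$ denotes the copy of $x$ in the $i$th copy of $\Lambda$ (the one starting at $\infty_i$). For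 positive integers $m,n$ the $m$-fold covering map $\phi^m_n:\Sigma^{(mn)}\to\Sigma^{(n)}$ is given by $\phi^m_n(\infty_i)=\infty_j$ and $\phi^m_n(\infty_i+x)=\infty_j+x$, where $j=i \bmod n$. For a sequence $\vec{p}=\langle p_1,p_2,\dots\rangle$ of positive integers, put $k(1)=1$ and $k(n)=p_1p_2\cdots p_{n-1}$ for $n>1$, and let $S(\Lambda,\vec{p})=\varprojlim\{\phi^{p_n}_{k(n)},\Sigma^{(k(n))},n\in\mathbb{N}\}$, the inverse limit with bonding maps $\phi^{p_n}_{k(n)}:\Sigma^{(k(n+1))}\to\Sigma^{(k(n))}$. *)

(* Defs.v *)
From HB Require Import structures.
From mathcomp Require Import all_boot all_order all_algebra generic_quotient.
From mathcomp Require Import all_classical all_reals topology.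

Set Implicit Arguments.
Unset Strict Implicit.
Unset Printing Implicit Defensive.

Import Order.TTheory.
Local Open Scope classical_set_scope.

Section Continua.
Implicit Types T U : topologicalType.

Definition homeomorphism T U (h : T -> U) : Prop :=
  continuous h /\ exists g : U -> T, [/\ continuous g, cancel h g & cancel g h].

Definition homogeneous T : Prop :=
  forall x y : T, exists2 h : T -> T, homeomorphism h & h x = y.

Definition metrizable T : Prop :=
  exists (R : realType) (M : metricType R) (h : T -> M), homeomorphism h.

Definition continuum T : Prop :=
  [/\ compact [set: T], connected [set: T] & hausdorff_space T].

(* Only used inside a Hausdorff space, so that [A] is itself a continuum. *)
Definition subcontinuum T (A : set T) : Prop :=
  [/\ A !=set0, compact A & connected A].

Definition indecomposable T : Prop :=
  ~ exists A B : set T,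
      [/\ subcontinuum A /\ A != setT,
          subcontinuum B /\ B != setT & A `|` B = setT].

Definition open_cover T (C : set (set T)) : Prop :=
  (forall A, C A -> open A) /\ \bigcup_(A in C) A = setT.

(* The indices are 0, ..., t-1 instead of 1, ..., t; the condition on [i] and
   [j] says that i - j is 0, 1 or -1 modulo t. *)
Definition circular_chain T t (U : 'I_t -> set T) : Prop :=
  forall i j : 'I_t, (U i `&` U j !=set0) <->
    [\/ i = j %[mod t], i = j.+1 %[mod t] | i.+1 = j %[mod t]].

Definition circle_like T : Prop :=
  forall C : set (set T), open_cover C ->
  exists (t : nat) (U : 'I_t -> set T),
    [/\ (0 < t)%N,
        open_cover (range U),
        forall i, exists2 A, C A & U i `<=` A
      & circular_chain U].

End Continua.

Section Circles.
Variables (d : Order.disp_t) (L : orderTopologicalType d).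

(* An [orderTopologicalType] carries a total order and its order topology. *)
Definition ordered_continuum : Prop :=
  [/\ exists x y : L, x != y, compact [set: L] & connected [set: L]].

Definition is_first (x : L) : Prop := forall y : L, (x <= y)%O.
Definition is_last (x : L) : Prop := forall y : L, (y <= x)%O.

(* n disjoint copies of L, with the disjoint union topology. *)
Definition copies (n : nat) : Type := {i : 'I_n & L}.

(* The index of the point infinity_j represented by [u], if [u] is an end point
   of its copy: the i-th copy runs from infinity_i to infinity_(i+1 mod n). *)
Definition end_index n (u : copies n) : option 'I_n :=
  if `[< is_first (tagged u) >] then Some (tag u)
  else if `[< is_last (tagged u) >] then Some (ordS (tag u))
  else None.

(* The last point of each copy is identified with the first point of the
   cyclically next one.  This performs at once the identifications that form
   L^(n) out of the n copies and the final one of the two ends of L^(n). *)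
Definition glue n (u v : copies n) : bool :=
  (u == v) || (end_index u && (end_index u == end_index v)).

Lemma glue_refl n : reflexive (@glue n).
Proof. by move=> u; rewrite /glue eqxx. Qed.

Lemma glue_sym n : symmetric (@glue n).
Proof.
move=> u v; rewrite /glue (eq_sym u v); congr (_ || _).
by case: (end_index u) (end_index v) => [i|] [j|] //=; rewrite [LHS]eq_sym.
Qed.

Lemma glue_trans n : transitive (@glue n).
Proof.
move=> v u w /orP[/eqP->//|/andP[u0 /eqP uv]] /orP[/eqP<-|/andP[_ /eqP vw]].
  by rewrite /glue u0 uv eqxx orbT.
by rewrite /glue u0 uv vw eqxx orbT.
Qed.

Canonical glue_equiv n :=
  EquivRel (@glue n) (@glue_refl n) (@glue_sym n) (@glue_trans n).

Definition circle (n : nat) : topologicalType :=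
  quotient_topology {eq_quot (glue_equiv n)}%qT.

Definition circle_proj n (u : copies n) : circle n :=
  (\pi_(circle n) u)%qT.

Lemma mod_ord_subproof m n (i : 'I_(m * n)) : (i %% n < n)%N.
Proof. by case: n i => [|n] i; [case: i; rewrite muln0|rewrite ltn_pmod]. Qed.

Definition mod_ord m n (i : 'I_(m * n)) : 'I_n := Ordinal (mod_ord_subproof i).

Definition copies_mod m n (u : copies (m * n)) : copies n :=
  existT _ (mod_ord (tag u)) (tagged u).

(* The m-fold covering map; [covering_mapE] shows that it does not depend on
   the chosen representative. *)
Definition covering_map m n (z : circle (m * n)) : circle n :=
  circle_proj (copies_mod (repr z)).

Lemma circle_projP n (u v : copies n) :
  reflect (circle_proj u = circle_proj v) (glue u v).
Proof. exact: (@eqmodP _ (glue_equiv n)). Qed.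

Lemma end_index_mod m n (u : copies (m * n)) :
  end_index (copies_mod u) = omap (@mod_ord m n) (end_index u).
Proof.
case: u => i x; rewrite /end_index /=; case: ifP => // _; case: ifP => //= _.
by congr Some; apply: val_inj; rewrite /= modn_dvdm ?dvdn_mull// -(addn1 (i %% n)) modnDml addn1.
Qed.

Lemma covering_mapE m n (u : copies (m * n)) :
  covering_map (circle_proj u) = circle_proj (copies_mod u).
Proof.
apply/circle_projP; rewrite /glue !end_index_mod.
have: glue (repr (circle_proj u)) u by apply/circle_projP; exact: reprK.
case/orP => [/eqP->|/andP[]]; first by rewrite eqxx.
by case: (end_index (repr _)) => //= k _ /eqP <-; rewrite eqxx orbT.
Qed.

(* The n-th circle of the inverse sequence has [winding p n] copies of L.
   Everything is indexed from 0: [p n] stands for p_(n+1). *)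
Fixpoint winding (p : nat -> nat) (n : nat) : nat :=
  if n is m.+1 then (p m * winding p m)%N else 1%N.

Lemma windingE p n : winding p n = (\prod_(i < n) p i)%N.
Proof. by elim: n => [|n IH]; rewrite ?big_ord0// big_ord_recr /= IH mulnC. Qed.

Definition circle_product (p : nat -> nat) : topologicalType :=
  prod_topology (fun n => circle (winding p n)).

(* The inverse limit, as a subspace of the product. *)
Definition solenoid (p : nat -> nat) : topologicalType :=
  set_type [set z : circle_product p |
    forall n, @covering_map (p n) (winding p n) (z n.+1) = z n].

End Circles.

(* Main.v *)
Require Import Defs.
From HB Require Import structures.
From mathcomp Require Import all_boot all_order all_algebra generic_quotient.
From mathcomp Require Import all_classical all_reals topology.
From mathcomp Require Import Rstruct lra zify.

Set Implicit Arguments.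
Unset Strict Implicit.
Unset Printing Implicit Defensive.

Import Order.TTheory.
Local Open Scope classical_set_scope.

(** The ordered continuum is the set of all sequences in the unit interval, with
    the lexicographic order and its order topology.  This order is complete and
    dense, so it is a continuum; the sequences with a given first term contain a
    nonempty open interval, so it carries uncountably many disjoint nonempty open
    sets.

    Homogeneity rests on a self-similarity: every segment [0,a] with 0 < a is
    order isomorphic to the whole order ([initial_segment]).  Indeed a is the
    limit of its truncations, two consecutive distinct truncations bound a
    segment isomorphic to the segment Z from 000... to 1000..., and Z is
    isomorphic both to Z followed by Z and to an infinite sequence of copies of Z
    followed by a last point.  As the whole order is reversed by t |-> 1 - t,
    each segment [0,a] and each segment [a,1] has an order-reversing involution
    ([left_reversal], [right_reversal]).  Reversing the two halves [0,a] and
    [a,1] of every copy and the cyclic order of the copies defines an involution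
    of every circle; it commutes with all the coverings and exchanges the points
    a of the copies with their end points.  It therefore acts on the inverse
    limit and moves a point with first coordinate a into the fibre over infinity.
    Rotations by whole copies act transitively on this fibre
    ([translate_to_base]), hence [solenoid_homogeneous].

    The other properties are reduced to one circle by compactness: an open cover
    of the inverse limit is so coarse that, at some level n, each fibre of the
    projection to the n-th circle lies in one of its members
    ([fibre_refinement]).  A separation of the inverse limit would thus come from
    one of a circle, and circular chains of closed arcs can be pulled back from a
    circle and thickened by normality ([closed_circular_chain], [swelling]).  For
    indecomposability, if the limit were the union of proper subcontinua A and B,
    then their images in some circle would omit points u and v.  In the next
    circle, the image of B avoids the fibre of v; the covering is a disjoint
    union of sheets off this fibre, so it is injective on the connected image of
    B ([covering_injective_of_connected]).  But the image of A avoids the fibre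
    of u, which has at least two points, so the image of B contains it.

    Finally a compact metrizable space has only countably many members in a
    disjoint family of nonempty open sets
    ([metrizable_countable_cellularity]). *)

(** * Isomorphisms between segments of a linear order *)

Section SegmentIsomorphisms.
Context {d : Order.disp_t} {T : orderType d}.
Local Open Scope order_scope.
Implicit Types a b c x y z : T.

Definition seg_bij (f : T -> T) a b a' b' :=
  [/\ forall x, a <= x <= b -> a' <= f x <= b',
      forall x y, a <= x -> x < y -> y <= b -> f x < f y
    & forall y, a' <= y <= b' -> exists2 x, a <= x <= b & f x = y].

Definition seg_iso a b a' b' := exists f, seg_bij f a b a' b'.

Lemma seg_bij_left f a b a' b' : seg_bij f a b a' b' -> a <= b -> a' <= b' ->
  f a = a'.
Proof.
move=> [fI fm fs] ab ab'.
have [|x /andP[ax xb] fx] := fs a'; first by rewrite lexx.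
move: ax; rewrite le_eqVlt => /predU1P[->//|ax].
have /andP[+ _] := fI a (introT andP (conj (lexx _) ab)).
by rewrite leNgt -fx fm.
Qed.

Lemma seg_bij_right f a b a' b' : seg_bij f a b a' b' -> a <= b -> a' <= b' ->
  f b = b'.
Proof.
move=> [fI fm fs] ab ab'.
have [|x /andP[ax xb] fx] := fs b'; first by rewrite lexx ab'.
move: xb; rewrite le_eqVlt => /predU1P[<-//|xb].
have /andP[_] := fI b (introT andP (conj ab (lexx _))).
by rewrite leNgt -fx fm.
Qed.

Lemma seg_iso_sym a b a' b' : seg_iso a b a' b' -> seg_iso a' b' a b.
Proof.
move=> [f [fI fm fs]].
have /choice[g gP] : forall y, exists x, a' <= y <= b' -> a <= x <= b /\ f x = y.
  move=> y; have [/fs[x xI fx]|] := boolP (a' <= y <= b'); first by exists x.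
  by exists y.
exists g; split=> [x /gP[]//|x y ax xy yb|x xI].
  have [gx fgx] : a <= g x <= b /\ f (g x) = x.
    by apply: gP; rewrite ax (le_trans (ltW xy)).
  have [gy fgy] : a <= g y <= b /\ f (g y) = y.
    by apply: gP; rewrite yb (le_trans ax (ltW xy)).
  rewrite ltNge le_eqVlt; apply/negP => /predU1P[e|lt].
    by move: xy; rewrite -fgx -fgy e ltxx.
  move: xy; rewrite -fgx -fgy ltNge ltW// fm//.
    by case/andP: gy.
  by case/andP: gx.
exists (f x); first exact: fI.
have [/andP[gx1 gx2] fgx] := gP _ (fI _ xI).
case/andP: xI => ax xb.
case: (ltgtP (g (f x)) x) => // lt.
  by have := fm _ _ gx1 lt xb; rewrite fgx ltxx.
by have := fm _ _ ax lt gx2; rewrite fgx ltxx.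
Qed.

Lemma seg_iso_trans a b a' b' a'' b'' :
  seg_iso a b a' b' -> seg_iso a' b' a'' b'' -> seg_iso a b a'' b''.
Proof.
move=> [f [fI fm fs]] [g [gI gm gs]]; exists (g \o f); split => /=.
- by move=> x /fI/gI.
- move=> x y ax xy yb.
  have /andP[fx _] : a' <= f x <= b' by apply: fI; rewrite ax (le_trans (ltW xy)).
  have /andP[_ fy] : a' <= f y <= b'.
    by apply: fI; rewrite yb (le_trans ax (ltW xy)).
  by apply: gm => //; exact: fm.
- by move=> z /gs[y /fs[x xI <-] <-]; exists x.
Qed.

Lemma seg_iso_cat a b c a' b' c' : a <= b -> b <= c -> a' <= b' -> b' <= c' ->
  seg_iso a b a' b' -> seg_iso b c b' c' -> seg_iso a c a' c'.
Proof.
move=> ab bc ab' bc' [f fP] [g gP].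
have gb := seg_bij_left gP bc bc'.
case: fP gP => [fI fm fs] [gI gm gs].
exists (fun x => if x <= b then f x else g x); split.
- move=> x /andP[ax xc]; case: (leP x b) => [xb|/ltW bx].
    by have /andP[-> /le_trans->] := fI x (introT andP (conj ax xb)).
  by have /andP[/(le_trans ab')-> ->] := gI x (introT andP (conj bx xc)).
- move=> x y ax xy yc; case: (leP x b) => [xb|bx]; case: (leP y b) => [yb|bY].
  + exact: fm.
  + have /andP[_ fx] := fI x (introT andP (conj ax xb)).
    by apply: le_lt_trans fx _; rewrite -gb; apply: gm.
  + by have := lt_le_trans (lt_trans bx xy) yb; rewrite ltxx.
  + by apply: gm => //; exact: ltW.
- move=> y /andP[ay yc]; have [yb|bY] := leP y b'.
    have [x /andP[ax xb] fx] := fs y (introT andP (conj ay yb)).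
    by exists x; rewrite ?ax ?xb ?(le_trans xb).
  have [x /andP[bx xc] gx] := gs y (introT andP (conj (ltW bY) yc)).
  exists x; rewrite ?(le_trans ab bx)//; case: (leP x b) => // xb.
  have xE : x = b by apply/le_anti; rewrite bx xb.
  by move: bY; rewrite -gx xE gb ltxx.
Qed.

Definition ladder (c : nat -> T) a :=
  [/\ forall i, c i < c i.+1, forall i, c i < a
    & forall y, y < a -> exists i, y < c i].

Lemma ladder_mono (c : nat -> T) a i j : ladder c a -> (i <= j)%N -> c i <= c j.
Proof.
move=> [ci _ _] ij; rewrite -(subnK ij); elim: (j - i)%N => // k IH.
by rewrite addSn (le_trans IH)// ltW.
Qed.

Lemma ladder_step (c : nat -> T) a x : ladder c a -> c 0%N <= x -> x < a ->
  exists i, c i <= x < c i.+1.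
Proof.
move=> ca c0x xa; have ex : exists i, x < c i by case: ca => _ _; exact.
case: (ex_minnP ex) => -[|i] xi mini; first by move: xi; rewrite ltNge c0x.
by exists i; rewrite xi andbT leNgt; apply/negP => /mini; rewrite ltnn.
Qed.

Lemma ladder_uniq (c : nat -> T) a x i j : ladder c a -> c i <= x < c i.+1 -> c j <= x ->
  (j <= i)%N.
Proof.
move=> ca /andP[_ xi] jx; rewrite leqNgt; apply/negP => ij.
by have := lt_le_trans (le_lt_trans jx xi) (ladder_mono ca ij); rewrite ltxx.
Qed.

(** Infinitely many isomorphisms between consecutive segments are glued into one;
    cofinality leaves only the last points, which are sent to each other. *)
Lemma seg_iso_ladder (c : nat -> T) a (c' : nat -> T) a' : ladder c a -> ladder c' a' ->
  (forall i, seg_iso (c i) (c i.+1) (c' i) (c' i.+1)) ->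
  seg_iso (c 0%N) a (c' 0%N) a'.
Proof.
move=> ca ca' /choice[f fP].
have /choice[ix ixP] : forall x, exists i,
    c 0%N <= x -> x < a -> c i <= x < c i.+1.
  move=> x; have [/andP[x1 x2]|nx] := boolP (c 0%N <= x < a).
    by have [i iP] := ladder_step ca x1 x2; exists i.
  by exists 0%N => x1 x2; rewrite x1 x2 in nx.
have cc i : c i <= c i.+1 by apply/ltW; case: ca.
have cc' i : c' i <= c' i.+1 by apply/ltW; case: ca'.
have cA i : c i < a by case: ca.
have cA' i : c' i < a' by case: ca'.
have fL i := seg_bij_left (fP i) (cc i) (cc' i).
have fR i := seg_bij_right (fP i) (cc i) (cc' i).
have fI i x : c i <= x < c i.+1 -> c' i <= f i x < c' i.+1.
  case: (fP i) => [fI fm _] /andP[ix1 ix2].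
  have /andP[-> _] := fI x (introT andP (conj ix1 (ltW ix2))).
  by rewrite -fR; apply: fm.
pose g x := if x < a then f (ix x) x else a'.
exists g; split.
- move=> x /andP[cx xa]; rewrite /g; case: (ltP x a) => [xa'|_].
    have /andP[h1 h2] := fI _ _ (ixP _ cx xa').
    rewrite (le_trans _ h1) ?(ladder_mono ca')//=.
    by rewrite (le_trans (ltW h2))// ltW.
  by rewrite lexx ltW.
- move=> x y cx xy ya; rewrite /g (lt_le_trans xy ya).
  have ixx := ixP _ cx (lt_le_trans xy ya).
  have /andP[h1 h2] := fI _ _ ixx.
  case: (ltP y a) => [ya'|_]; last exact: lt_trans h2 _.
  have ixy := ixP _ (le_trans cx (ltW xy)) ya'.
  have : (ix x <= ix y)%N.
    by apply: (ladder_uniq ca ixy); case/andP: ixx => /le_trans-> //; exact: ltW.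
  rewrite leq_eqVlt => /predU1P[e|lt].
    rewrite -e in ixy *; case: (fP (ix x)) => _ fm _; apply: fm => //.
      by case/andP: ixx.
    by case/andP: ixy => _ /ltW.
  apply: lt_le_trans h2 _; have /andP[+ _] := fI _ _ ixy.
  by apply: le_trans; exact: (ladder_mono ca').
- move=> y /andP[cy]; rewrite le_eqVlt => /predU1P[->|ya].
    by exists a; rewrite /g ?ltxx// lexx ltW.
  have [j /andP[jy yj]] := ladder_step ca' cy ya.
  case: (fP j) => [fI' fm fs].
  have [x /andP[jx xj] fx] := fs y (introT andP (conj jy (ltW yj))).
  have xj' : x < c j.+1.
    rewrite lt_neqAle xj andbT; apply/negP => /eqP e.
    by move: yj; rewrite -fx e fR ltxx.
  have xa : x < a by apply: lt_trans xj' _.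
  have cx : c 0%N <= x by rewrite (le_trans _ jx)// (ladder_mono ca).
  exists x; first by rewrite cx ltW.
  rewrite /g xa -fx; congr (f _ x); apply/eqP; rewrite eqn_leq.
  apply/andP; split; last exact: (ladder_uniq ca (ixP _ cx xa)).
  by apply: (ladder_uniq ca (x := x)); [rewrite jx | case/andP: (ixP _ cx xa)].
Qed.

End SegmentIsomorphisms.

(** * The unit interval *)

Section UnitInterval.
Import GRing.Theory Num.Theory.
Variable R : realType.
Local Open Scope ring_scope.

Definition unit_itv : Type := {r : R | 0 <= r <= 1}.

HB.instance Definition _ := SubChoice.on unit_itv.
HB.instance Definition _ := [SubChoice_isSubOrder of unit_itv by <: with ring_display].

Implicit Types s t x y : unit_itv.

Definition unitI (r : R) (rP : 0 <= r <= 1) : unit_itv := exist _ r rP.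

Lemma unitI_ltE s t : (s < t)%O = (\val s < \val t). Proof. by []. Qed.
Lemma unitI_leE s t : (s <= t)%O = (\val s <= \val t). Proof. by []. Qed.

Fact zero_subproof : 0 <= (0 : R) <= 1. Proof. by rewrite lexx ler01. Qed.
Fact one_subproof : 0 <= (1 : R) <= 1. Proof. by rewrite lexx ler01. Qed.

Definition zeroI : unit_itv := unitI zero_subproof.
Definition oneI : unit_itv := unitI one_subproof.

Lemma unitI_ge0 x : (zeroI <= x)%O. Proof. by rewrite unitI_leE; case: x => x /= /andP[]. Qed.
Lemma unitI_le1 x : (x <= oneI)%O. Proof. by rewrite unitI_leE; case: x => x /= /andP[]. Qed.

Lemma zeroI_lt_oneI : (zeroI < oneI)%O.
Proof. by rewrite unitI_ltE /= ltr01. Qed.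

Fact flip_subproof x : 0 <= 1 - \val x <= 1.
Proof. by have := unitI_ge0 x; have := unitI_le1 x; rewrite !unitI_leE /=; lra. Qed.

Definition flipI x : unit_itv := unitI (flip_subproof x).

Lemma flipI0 : flipI zeroI = oneI.
Proof. by apply: val_inj; rewrite /= subr0. Qed.

Lemma flipIK : involutive flipI.
Proof. by move=> x; apply: val_inj => /=; rewrite subKr. Qed.

Lemma flipI_lt x y : (x < y)%O -> (flipI y < flipI x)%O.
Proof. by rewrite !unitI_ltE /=; lra. Qed.

Lemma unitI_sup (A : set unit_itv) : exists s,
  (forall x, A x -> (x <= s)%O) /\ forall y, (y < s)%O -> exists2 x, A x & (y < x)%O.
Proof.
have [->|/set0P[a Aa]] := eqVneq A set0.
  by exists zeroI; split=> // y; rewrite ltNge unitI_ge0.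
pose B := [set \val x | x in A].
have B0 : B !=set0 by exists (\val a); exists a.
have Bub : ubound B 1 by move=> _ [x _ <-]; exact: unitI_le1.
have supB : has_sup B by split=> //; exists 1.
have sB : 0 <= sup B <= 1.
  rewrite ge_sup// andbT; apply: (@le_trans _ _ (\val a)); first exact: unitI_ge0.
  by apply: ub_le_sup; [exists 1|exists a].
exists (unitI sB); split=> [x Ax|y]; first by rewrite unitI_leE /= ub_le_sup//; [exists 1|exists x].
rewrite unitI_ltE /= => /sup_gt /= /(_ B0)[_ [x Ax <-] yx]; by exists x.
Qed.

Lemma unitI_dense x y : (x < y)%O -> exists2 z, (x < z)%O & (z < y)%O.
Proof.
case: x y => x xP [y yP]; rewrite unitI_ltE /= => xy.
have zP : 0 <= (x + y) / 2 <= 1 by lra.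
by exists (unitI zP); rewrite unitI_ltE /=; lra.
Qed.

(** The affine map between the two segments; the default value of [insubd] is
    only taken outside the first one. *)
Lemma unitI_stretch s t s' t' : (s < t)%O -> (s' < t')%O -> seg_iso s t s' t'.
Proof.
rewrite !unitI_ltE => st st'; pose q : R := (\val t' - \val s') / (\val t - \val s).
have q0 : 0 < q by rewrite divr_gt0// subr_gt0.
have qE : q * (\val t - \val s) = \val t' - \val s'.
  by rewrite /q divfK// gt_eqF// subr_gt0.
pose h (u : R) := \val s' + q * (u - \val s).
have hs : h (\val s) = \val s' by rewrite /h subrr mulr0 addr0.
have ht : h (\val t) = \val t' by rewrite /h qE; lra.
have hlt u v : (h u < h v) = (u < v) by rewrite ltrD2l ltr_pM2l// ltrD2r.
have hle u v : (h u <= h v) = (u <= v) by rewrite lerD2l ler_pM2l// lerD2r.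
exists (fun x => insubd s' (h (\val x))).
have hP x : (s <= x <= t)%O -> 0 <= h (\val x) <= 1.
  rewrite !unitI_leE => /andP[sx xt]; apply/andP; split.
    by apply: (@le_trans _ _ (\val s')); [exact: unitI_ge0|rewrite -[leLHS]hs hle].
  by apply: (@le_trans _ _ (\val t')); [rewrite -[leRHS]ht hle|exact: unitI_le1].
split.
- move=> x xI; rewrite !unitI_leE val_insubd hP//; case/andP: xI => sx xt.
  apply/andP; split.
    by rewrite -[leLHS]hs hle.
  by rewrite -[leRHS]ht hle.
- move=> x y sx xy yt; rewrite unitI_ltE !val_insubd !hP ?hlt//.
    by rewrite yt (le_trans sx (ltW xy)).
  by rewrite sx (le_trans (ltW xy)).
- move=> y; rewrite !unitI_leE => /andP[sy yt].
  pose x := \val s + (\val y - \val s') / q.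
  have hx : h x = \val y.
    by rewrite /h /x [X in q * X]addrC addKr mulrCA divff ?gt_eqF// mulr1; lra.
  have sx : \val s <= x by rewrite -hle hx hs.
  have xt : x <= \val t by rewrite -hle hx ht.
  have xP : 0 <= x <= 1.
    by rewrite (le_trans _ sx) ?(le_trans xt)//; [exact: unitI_le1|exact: unitI_ge0].
  exists (unitI xP); first by rewrite !unitI_leE /= sx.
  by apply: val_inj; rewrite val_insubd /= hx; case: (y) => /= y' ->.
Qed.

Fact rungI_subproof n : 0 <= (1 - n.+1%:R^-1 : R) <= 1.
Proof.
have n0 : 0 < n.+1%:R^-1 :> R by rewrite invr_gt0 ltr0n.
have n1 : n.+1%:R^-1 <= 1 :> R by rewrite invf_le1 ?ltr0n// ler1n.
by rewrite subr_ge0 n1 lerBlDr lerDl ltW.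
Qed.

Definition rungI n : unit_itv := unitI (rungI_subproof n).

Lemma rungI0 : rungI 0 = zeroI.
Proof. by apply: val_inj => /=; rewrite invr1 subrr. Qed.

Lemma ladder_rungI : ladder rungI oneI.
Proof.
split=> [i|i|y]; rewrite unitI_ltE /=.
- by rewrite ltrD2l ltrN2 ltf_pV2 ?posrE ?ltr0n// ltr_nat.
- by rewrite -subr_gt0 subKr invr_gt0 ltr0n.
- move=> y1; have [//|k] := @ltr_add_invr R (\val y) 1.
  by move=> yk; exists k; rewrite unitI_ltE /= ltrBrDr.
Qed.

End UnitInterval.

Arguments zeroI_lt_oneI {R}.

(** * Lexicographically ordered sequences *)

Section Lexicographic.
Variable R : realType.
Local Notation I := (unit_itv R).
Local Notation "0" := (zeroI R).
Local Notation "1" := (oneI R).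
Local Open Scope order_scope.

Definition lexseq : Type := nat -> I.

HB.instance Definition _ := gen_eqMixin lexseq.
HB.instance Definition _ := gen_choiceMixin lexseq.

Implicit Types x y z a b : lexseq.

Definition agree_below n x y := forall k, (k < n)%N -> x k = y k.

Definition lex_prec x y := exists2 n, agree_below n x y & x n < y n.

Let lex_lt x y := `[< lex_prec x y >].
Let lex_le x y := (x == y) || lex_lt x y.

Lemma agree_sym n x y : agree_below n x y -> agree_below n y x.
Proof. by move=> xy k /xy. Qed.

Lemma first_difference x y : x <> y -> exists2 n, agree_below n x y & x n != y n.
Proof.
move=> xy; have ex : exists n, x n != y n.
  apply: contrapT => nex; apply: xy; apply/funext => n.
  by apply/eqP; apply: contrapT => /negP h; apply: nex; exists n.
case: (ex_minnP ex) => n xyn mini; exists n => // k kn.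
by apply/eqP; apply: contraLR kn => /mini; rewrite -leqNgt.
Qed.

Lemma lex_prec_irr x : ~ lex_prec x x.
Proof. by case=> n _; rewrite ltxx. Qed.

Lemma lex_prec_trans x y z : lex_prec x y -> lex_prec y z -> lex_prec x z.
Proof.
move=> [m xy ltm] [n yz ltn]; case: (ltngtP m n) => [mn|nm|e].
- by exists m; [move=> k km; rewrite xy// yz// (ltn_trans km)|rewrite -yz].
- by exists n; [move=> k kn; rewrite xy// ?yz// (ltn_trans kn)|rewrite xy].
- subst n; exists m; [by move=> k km; rewrite xy// yz|exact: lt_trans ltm ltn].
Qed.

Lemma lex_prec_total x y : x <> y -> lex_prec x y \/ lex_prec y x.
Proof.
move=> /first_difference[n xy]; rewrite neq_lt => /orP[lt|lt].
  by left; exists n.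
by right; exists n => //; exact: agree_sym.
Qed.

Fact lex_lt_def x y : lex_lt x y = (y != x) && lex_le x y.
Proof.
rewrite /lex_le eq_sym; case: eqVneq => //= ->.
by apply/asboolP; exact: lex_prec_irr.
Qed.

Fact lex_le_anti : antisymmetric lex_le.
Proof.
move=> x y /andP[/predU1P[//|/asboolP xy] /predU1P[//|/asboolP yx]].
by case: (lex_prec_irr (lex_prec_trans xy yx)).
Qed.

Fact lex_le_trans : transitive lex_le.
Proof.
move=> y x z /predU1P[->//|/asboolP xy] /predU1P[<-|/asboolP yz].
  by apply/orP; right; apply/asboolP.
by apply/orP; right; apply/asboolP; exact: lex_prec_trans yz.
Qed.

Fact lex_le_total : total lex_le.
Proof.
move=> x y; rewrite /lex_le; case: eqVneq => //= /eqP/lex_prec_total[]h.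
  by rewrite [lex_lt x y](_ : _ = true)//; exact/asboolP.
by rewrite [lex_lt y x](_ : _ = true) ?orbT//; exact/asboolP.
Qed.

HB.instance Definition _ := Order.isOrder.Build ring_display lexseq
  lex_lt_def (fun _ _ => erefl) (fun _ _ => erefl)
  lex_le_anti lex_le_trans lex_le_total.

Lemma lex_ltP x y : x < y <-> lex_prec x y.
Proof. by split=> /asboolP. Qed.

Definition lex_bot : lexseq := fun=> 0.
Definition lex_top : lexseq := fun=> 1.

Lemma lex_ge0 x : lex_bot <= x.
Proof.
rewrite leNgt; apply/negP => /lex_ltP[n _].
by rewrite ltNge unitI_ge0.
Qed.

Lemma lex_le1 x : x <= lex_top.
Proof.
rewrite leNgt; apply/negP => /lex_ltP[n _].
by rewrite ltNge unitI_le1.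
Qed.

Definition lex_flip x : lexseq := fun n => flipI (x n).

Lemma lex_flipK : involutive lex_flip.
Proof. by move=> x; apply/funext => n; exact: flipIK. Qed.

Lemma lex_flip_lt x y : x < y -> lex_flip y < lex_flip x.
Proof.
move=> /lex_ltP[n xy lt]; apply/lex_ltP; exists n; last exact: flipI_lt.
by move=> k kn; rewrite /lex_flip xy.
Qed.

Lemma lex_dense x y : x < y -> exists2 z, x < z & z < y.
Proof.
move=> /lex_ltP[n xy /unitI_dense[c xc cy]].
pose z : lexseq := fun k => if k == n then c else x k.
have zn : z n = c by rewrite /z eqxx.
have zk : agree_below n z x by move=> k kn; rewrite /z ltn_eqF.
exists z; apply/lex_ltP; exists n; rewrite ?zn//.
  exact: agree_sym.
by move=> k kn; rewrite zk// xy.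
Qed.

(** The supremum is built term by term: its n-th term is the supremum of the n-th
    terms of those members of [A] that agree with it below n.  When no member
    agrees with it so far, this is the supremum of the empty set, namely 0. *)
Lemma lex_sup (A : set lexseq) : exists s,
  (forall x, A x -> x <= s) /\ forall y, y < s -> exists2 x, A x & y < x.
Proof.
have /choice[lub lubP] := @unitI_sup R.
pose next n w : I := lub [set x n | x in [set x | A x /\ agree_below n x w]].
(* [W n] has the right terms below [n] and junk from [n] on. *)
pose W := fix W n : lexseq :=
  if n is m.+1 then fun k => if k == m then next m (W m) else W m k else lex_bot.
pose s : lexseq := fun n => W n.+1 n.
have Ws n : agree_below n (W n) s.
  elim: n => // n IH k; rewrite ltnS leq_eqVlt /s => /predU1P[->//|kn].
  by rewrite /= ltn_eqF// IH.
have sE n : s n = lub [set x n | x in [set x | A x /\ agree_below n x s]].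
  rewrite {1}/s /= eqxx /next; congr lub; congr image.
  apply/seteqP; split=> x [Ax xw]; split=> // k kn; rewrite xw//.
    exact: Ws.
  by rewrite Ws.
exists s; split=> [x Ax|y /lex_ltP[n ys]].
  rewrite leNgt; apply/negP => /lex_ltP[n sx]; rewrite sE ltNge => /negP; apply.
  by apply: (lubP _).1; exists x => //; split=> //; exact: agree_sym.
rewrite sE => /(lubP _).2[_ [x [Ax xs] <-] yx].
by exists x => //; apply/lex_ltP; exists n => // k kn; rewrite ys// xs.
Qed.

Definition lex_cons s x : lexseq := fun k => if k is j.+1 then x j else s.

Definition lex_behead x : lexseq := fun k => x k.+1.

Definition lex_splice n a x : lexseq :=
  fun k => if (k < n)%N then a k else x (k - n)%N.

Lemma lex_consK x : lex_cons (x O) (lex_behead x) = x.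
Proof. by apply/funext => -[]. Qed.

Lemma lex_cons_lt s t x y : s < t -> lex_cons s x < lex_cons t y.
Proof. by move=> st; apply/lex_ltP; exists O. Qed.

Lemma lex_botE : lex_bot = lex_cons 0 lex_bot.
Proof. by apply/funext => -[]. Qed.

Lemma lex_splice_lt n a x y : (lex_splice n a x < lex_splice n a y) = (x < y).
Proof.
have lt u v : u < v -> lex_splice n a u < lex_splice n a v.
  move=> /lex_ltP[k uv ltk]; apply/lex_ltP; exists (n + k)%N.
    by move=> j jk; rewrite /lex_splice; case: ltnP => // nj; apply: uv; rewrite ltn_subLR.
  by rewrite /lex_splice ltnNge leq_addr /= addKn.
apply/idP/idP; last exact: lt.
apply: contraTT; rewrite -!leNgt le_eqVlt => /predU1P[->//|/lt/ltW//].
Qed.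

Lemma lex_splice_le n a x y : (lex_splice n a x <= lex_splice n a y) = (x <= y).
Proof. by rewrite !leNgt lex_splice_lt. Qed.

(** A common prefix of the end points of a segment is shared by all its members. *)
Lemma splice_convex n a u v x : lex_splice n a u <= x -> x <= lex_splice n a v ->
  exists w, x = lex_splice n a w.
Proof.
move=> ux xv; exists (fun k => x (n + k)%N); apply/funext => k.
rewrite /lex_splice; case: ltnP => [kn|nk]; last by rewrite subnKC.
have [xa|] := pselect (agree_below n x a); first exact: xa.
move=> nxa; exfalso.
have /first_difference[m] : x <> lex_splice n a u.
  by move=> e; apply: nxa => j jn; rewrite e /lex_splice jn.
have [mn xum xm|nm xum _] := ltnP m n; last first.
  by apply: nxa => j jn; rewrite (xum j (leq_trans jn nm)) /lex_splice jn.
have sa w j : (j < n)%N -> lex_splice n a w j = a j by rewrite /lex_splice => ->.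
move: xm; rewrite sa// neq_lt => /orP[lt|lt].
  have : x < lex_splice n a u by apply/lex_ltP; exists m; rewrite ?sa.
  by rewrite ltNge ux.
have : lex_splice n a v < x.
  apply/lex_ltP; exists m; rewrite ?sa// => j jm.
  by rewrite xum// !sa ?(ltn_trans jm).
by rewrite ltNge xv.
Qed.

Lemma seg_iso_splice n a u v : seg_iso u v (lex_splice n a u) (lex_splice n a v).
Proof.
exists (lex_splice n a); split=> [x /andP[ux xv]|x y _ xy _|y /andP[uy yv]].
- by rewrite !lex_splice_le ux.
- by rewrite lex_splice_lt.
- have [x xE] := splice_convex uy yv; exists x => //.
  by rewrite -(lex_splice_le n a) -xE uy -(lex_splice_le n a) -xE yv.
Qed.

Lemma lex_cons_le s x y : (lex_cons s x <= lex_cons s y) = (x <= y).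
Proof.
suff E z : lex_cons s z = lex_splice 1 (fun=> s) z by rewrite !E lex_splice_le.
by apply/funext => -[//|k]; rewrite /lex_splice /= subn1.
Qed.

Lemma lex_cons_le_head s t x y : lex_cons s x <= lex_cons t y -> s <= t.
Proof. by apply: contraTT; rewrite -!ltNge => /lex_cons_lt. Qed.

(** Only the head is rescaled, the tail is kept.  The end points have the least
    possible tail, so no tail is cut off at the left end and the right end
    carries a single point. *)
Lemma seg_iso_cons s t s' t' : s < t -> s' < t' ->
  seg_iso (lex_cons s lex_bot) (lex_cons t lex_bot) (lex_cons s' lex_bot) (lex_cons t' lex_bot).
Proof.
move=> st st'; have [f fP] := unitI_stretch st st'.
have ft := seg_bij_right fP (ltW st) (ltW st').
case: fP => fI fm fs.
exists (fun x => lex_cons (f (x O)) (lex_behead x)); split.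
- move=> x /andP[]; rewrite -{1 2}(lex_consK x) => sx xt.
  have /andP[h1 h2] := fI _ (introT andP (conj (lex_cons_le_head sx) (lex_cons_le_head xt))).
  apply/andP; split.
    move: h1; rewrite le_eqVlt => /predU1P[<-|]; last by move/lex_cons_lt/ltW.
    by rewrite lex_cons_le lex_ge0.
  have := lex_cons_le_head xt; rewrite le_eqVlt => /predU1P[e|lt].
    by move: xt; rewrite e ft !lex_cons_le.
  apply/ltW/lex_cons_lt; rewrite -ft; apply: fm => //.
  exact: lex_cons_le_head sx.
- move=> x y; rewrite -{1}(lex_consK x) => /lex_cons_le_head sx xy.
  rewrite -{1}(lex_consK y) => /lex_cons_le_head yt.
  case/lex_ltP: xy => -[|n] xy lt; first exact/lex_cons_lt/fm.
  apply/lex_ltP; exists n.+1 => //= -[_ /=|k kn /=]; first by rewrite xy.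
  by rewrite /lex_behead xy.
- move=> y /andP[]; rewrite -{1 2}(lex_consK y) => sy yt.
  have [r /andP[sr rt] fr] :=
    fs _ (introT andP (conj (lex_cons_le_head sy) (lex_cons_le_head yt))).
  exists (lex_cons r (lex_behead y)); last by rewrite /= fr (lex_consK y).
  apply/andP; split.
    move: sr; rewrite le_eqVlt => /predU1P[<-|]; last by move/lex_cons_lt/ltW.
    by rewrite lex_cons_le lex_ge0.
  move: rt; rewrite le_eqVlt => /predU1P[e|]; last by move/lex_cons_lt/ltW.
  by move: yt; rewrite -fr e ft !lex_cons_le.
Qed.

Definition lex_unit : lexseq := lex_cons 1 lex_bot.

Definition lex_trunc n a : lexseq := lex_splice n a lex_bot.

Lemma lex_trunc0 a : lex_trunc 0 a = lex_bot.
Proof. by []. Qed.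

Lemma lex_truncS n a : lex_trunc n.+1 a = lex_splice n a (lex_cons (a n) lex_bot).
Proof.
apply/funext => k; rewrite /lex_trunc /lex_splice ltnS.
case: (ltngtP k n) => [//|nk|->]; last by rewrite subnn.
by rewrite -(subnSK nk).
Qed.

Lemma lex_truncE n a : lex_trunc n a = lex_splice n a (lex_cons 0 lex_bot).
Proof. by rewrite -lex_botE. Qed.

(** Consecutive truncations have a common prefix followed by a head 0 and [a n],
    so they bound a copy of the segment from [lex_bot] to [lex_unit]. *)
Lemma trunc_step n a : a n != 0 -> lex_trunc n a < lex_trunc n.+1 a /\
  seg_iso lex_bot lex_unit (lex_trunc n a) (lex_trunc n.+1 a).
Proof.
move=> an; have an0 : 0 < a n by rewrite lt_neqAle eq_sym an unitI_ge0.
rewrite lex_truncE lex_truncS lex_splice_lt lex_cons_lt//; split=> //.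
apply: seg_iso_trans (seg_iso_splice _ _ _ _).
by rewrite [X in seg_iso X _]lex_botE; exact: seg_iso_cons zeroI_lt_oneI _.
Qed.

(** Rescaling the head shows that the segment from [lex_bot] to [lex_unit] is the
    concatenation of two copies of itself. *)
Lemma seg_iso_double a b c : a < b -> b < c -> seg_iso lex_bot lex_unit a b ->
  seg_iso lex_bot lex_unit b c -> seg_iso lex_bot lex_unit a c.
Proof.
move=> ab bc ZA ZB; have [h h0 h1] := unitI_dense (@zeroI_lt_oneI R).
apply: (seg_iso_cat (b := lex_cons h lex_bot) (b' := b)); rewrite ?(ltW ab) ?(ltW bc) ?lex_ge0//.
- exact/ltW/lex_cons_lt.
- apply: seg_iso_trans ZA; rewrite [X in seg_iso X]lex_botE [X in seg_iso _ _ X]lex_botE.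
  exact: seg_iso_cons _ (@zeroI_lt_oneI R).
- apply: seg_iso_trans ZB; rewrite [X in seg_iso _ _ X]lex_botE.
  exact: seg_iso_cons _ (@zeroI_lt_oneI R).
Qed.

Lemma trunc_segment m n a : (m <= n)%N -> lex_trunc m a = lex_trunc n a \/
  (lex_trunc m a < lex_trunc n a /\ seg_iso lex_bot lex_unit (lex_trunc m a) (lex_trunc n a)).
Proof.
elim: n => [|n IH]; first by rewrite leqn0 => /eqP->; left.
rewrite leq_eqVlt => /predU1P[->|/IH {}IH]; first by left.
have [an0|an0] := eqVneq (a n) 0.
  suff -> : lex_trunc n.+1 a = lex_trunc n a by [].
  by rewrite lex_truncS lex_truncE an0.
have [lt iso] := trunc_step an0.
case: IH => [->|[lt' iso']]; first by right.
by right; split; [exact: lt_trans lt|exact: (seg_iso_double lt' lt)].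
Qed.

Lemma trunc_lt_self n a : lex_trunc n a <> a ->
  exists m, (n < m)%N && (lex_trunc n a < lex_trunc m a).
Proof.
move=> na; have [k nak] : exists k, lex_trunc n a k != a k.
  apply: contrapT => nex; apply: na; apply/funext => k.
  by apply/eqP; apply: contrapT => /negP h; apply: nex; exists k.
have nk : (n <= k)%N.
  by rewrite leqNgt; apply/negP => kn; move: nak; rewrite /lex_trunc /lex_splice kn eqxx.
exists k.+1; rewrite ltnS nk /=.
have [e|[]//] := @trunc_segment n k.+1 a (leqW nk).
by move: nak; rewrite e /lex_trunc /lex_splice ltnSn eqxx.
Qed.

Lemma trunc_le n a : lex_trunc n a <= a.
Proof.
have [->//|/eqP /trunc_lt_self] := eqVneq (lex_trunc n a) a.
have aE : a = lex_splice n a (fun k => a (n + k)%N).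
  by apply/funext => k; rewrite /lex_splice; case: ltnP => // /subnKC->.
by rewrite [leRHS]aE lex_splice_le lex_ge0.
Qed.

Lemma trunc_cofinal y a : y < a -> exists n, y < lex_trunc n a.
Proof.
move=> /lex_ltP[n ya lt]; exists n.+1; apply/lex_ltP; exists n.
  by move=> k kn; rewrite /lex_trunc /lex_splice ltnS (ltnW kn) ya.
by rewrite /lex_trunc /lex_splice ltnSn.
Qed.

Lemma trunc_mono m n a : (m <= n)%N -> lex_trunc m a <= lex_trunc n a.
Proof. by case/(@trunc_segment m n a) => [->//|[/ltW]]. Qed.

(** Either [a] is one of its truncations and finitely many steps reach it, or
    infinitely many steps form a ladder below [a].  In the second case this
    ladder is matched with the ladder below [lex_unit] formed by the heads
    [rungI], each followed by zeros. *)
Lemma initial_segment_unit a : a != lex_bot -> seg_iso lex_bot a lex_bot lex_unit.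
Proof.
move=> a0; have [[n na]|inf] := pselect (exists n, lex_trunc n a = a).
  have [|[_]] := @trunc_segment 0 n a (leq0n n).
    by rewrite na lex_trunc0 => e; rewrite -e eqxx in a0.
  by rewrite na lex_trunc0; exact: seg_iso_sym.
have /choice[g gP] n := trunc_lt_self (fun na : lex_trunc n a = a => inf (ex_intro _ n na)).
pose N i := iter i g 0%N.
have Ni i : (i <= N i)%N.
  by elim: i => // i IH; rewrite (leq_ltn_trans IH)//=; case/andP: (gP (N i)).
have cL : ladder (fun i => lex_trunc (N i) a) a.
  split=> [i|i|y].
  - by rewrite /=; case/andP: (gP (N i)).
  - by rewrite lt_neqAle trunc_le andbT; apply/eqP => e; apply: inf; exists (N i).
  - move=> /trunc_cofinal[n yn]; exists n.
    by apply: lt_le_trans yn _; exact: trunc_mono.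
have uL : ladder (fun i => lex_cons (rungI R i) lex_bot) lex_unit.
  have [r1 r2 r3] := ladder_rungI R.
  split=> [i|i|y]; [exact: lex_cons_lt|exact: lex_cons_lt|].
  move=> /lex_ltP[[|n] yu].
    by move=> /r3[i yi]; exists i; rewrite -(lex_consK y); exact: lex_cons_lt.
  by rewrite ltNge unitI_ge0.
have := seg_iso_ladder cL uL; rewrite /= lex_trunc0 rungI0 -lex_botE; apply=> i.
have /andP[/ltnW gi lti] := gP (N i).
have [e|[_ iso]] := @trunc_segment _ _ a gi; first by move: lti; rewrite e ltxx.
apply: seg_iso_trans (seg_iso_sym iso) _; rewrite [X in seg_iso X]lex_botE.
by apply: seg_iso_cons zeroI_lt_oneI _; case: (ladder_rungI R).
Qed.

Lemma initial_segment a : a != lex_bot -> seg_iso lex_bot a lex_bot lex_top.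
Proof.
move=> a0; apply: seg_iso_trans (initial_segment_unit a0) _.
apply/seg_iso_sym/initial_segment_unit.
by rewrite gt_eqF//; apply/lex_ltP; exists O => //; exact: zeroI_lt_oneI.
Qed.

(** Transport of the reversal of the whole order along [initial_segment]. *)
Lemma left_reversal a : a != lex_bot -> exists r : lexseq -> lexseq,
  (forall x, x <= a -> r x <= a /\ r (r x) = x) /\
  (forall x y, x < y -> y <= a -> r y < r x).
Proof.
move=> a0; have iso := initial_segment a0.
have [f [fI fm fs]] := iso.
have /choice[g gP] : forall y, exists x, x <= a /\ f x = y.
  move=> y; have [|x /andP[_ xa] <-] := fs y; last by exists x.
  by rewrite lex_ge0 lex_le1.
have gf x : x <= a -> g (f x) = x.
  move=> xa; have [ga fg] := gP (f x); apply/eqP; case: (ltgtP (g (f x)) x) => // lt.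
    by have := fm _ _ (lex_ge0 _) lt xa; rewrite fg ltxx.
  by have := fm _ _ (lex_ge0 _) lt ga; rewrite fg ltxx.
exists (fun x => g (lex_flip (f x))); split=> [x xa|x y xy ya].
  have [ra fr] := gP (lex_flip (f x)); split=> //.
  by rewrite fr lex_flipK gf.
have [rxa frx] := gP (lex_flip (f x)).
have [rya fry] := gP (lex_flip (f y)).
have lt : lex_flip (f y) < lex_flip (f x) by apply/lex_flip_lt/fm => //; exact: lex_ge0.
rewrite ltNge le_eqVlt; apply/negP => /predU1P[e|lt'].
  by move: lt; rewrite -frx -fry e ltxx.
have := fm _ _ (lex_ge0 _) lt' rya; rewrite frx fry => /(lt_trans lt).
by rewrite ltxx.
Qed.

(** Conjugating [left_reversal] with the reversal of the whole order. *)
Lemma right_reversal a : a != lex_top -> exists r : lexseq -> lexseq,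
  (forall x, a <= x -> a <= r x /\ r (r x) = x) /\
  (forall x y, x < y -> a <= x -> r y < r x).
Proof.
move=> a1; have flip_le x y : x <= y -> lex_flip y <= lex_flip x.
  by rewrite le_eqVlt => /predU1P[->//|/lex_flip_lt/ltW].
have [|r [rI rm]] := @left_reversal (lex_flip a).
  by apply: contra a1 => /eqP e; rewrite -(lex_flipK a) e;
    apply/eqP/funext => k; exact: flipI0.
exists (fun x => lex_flip (r (lex_flip x))); split=> [x ax|x y xy ax].
  have [ra rr] := rI _ (flip_le _ _ ax); split.
    by rewrite -(lex_flipK a); exact: flip_le.
  by rewrite lex_flipK rr lex_flipK.
by apply/lex_flip_lt/rm; [exact: lex_flip_lt|exact: flip_le].
Qed.

End Lexicographic.

(** * The order topology of a complete dense order *)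

Lemma clopen_locally_constant (T : topologicalType) (B : set T) : open B -> closed B ->
  forall x : T, \forall y \near x, B y <-> B x.
Proof.
move=> oB cB x; have [Bx|nBx] := pselect (B x).
  by apply: filterS (open_nbhs_nbhs (conj oB Bx)) => y By; split.
have oC : open (~` B) by exact: closed_openC.
by apply: filterS (open_nbhs_nbhs (conj oC nBx)) => y By; split.
Qed.

Definition complete_order d (L : orderType d) := forall A : set L, exists s,
  (forall x, A x -> x <= s)%O /\ forall y, (y < s)%O -> exists2 x, A x & (y < x)%O.

Definition dense_order d (L : orderType d) :=
  forall x y : L, (x < y)%O -> exists2 z, (x < z)%O & (z < y)%O.

Section CompleteDenseOrder.
Context {d : Order.disp_t} {L : orderTopologicalType d}.
Local Open Scope order_scope.
Implicit Types x y z : L.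

Lemma nbhs_left x (U : set L) : nbhs x U ->
  (exists2 l, l < x & forall y, l < y -> y <= x -> U y) \/
  (forall y, y <= x -> U y).
Proof.
rewrite itv_nbhsE => -[[l r] [io xi] iU].
case: l io xi iU => [[] l|[]] //; case: r => [[] r|[]] // io;
  rewrite in_itv /= ?andbT => xi iU.
- left; exists l; first by case/andP: xi.
  by move=> y ly yx; apply: iU; rewrite /= in_itv /= ly (le_lt_trans yx)//; case/andP: xi.
- by left; exists l => // y ly yx; apply: iU; rewrite /= in_itv /= ly.
- by right=> y yx; apply: iU; rewrite /= in_itv /= (le_lt_trans yx).
- by right=> y yx; apply: iU; rewrite /= in_itv.
Qed.

Lemma nbhs_right x (U : set L) : nbhs x U ->
  (exists2 r, x < r & forall y, x <= y -> y < r -> U y) \/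
  (forall y, x <= y -> U y).
Proof.
rewrite itv_nbhsE => -[[l r] [io xi] iU].
case: l io xi iU => [[] l|[]] //; case: r => [[] r|[]] // io;
  rewrite in_itv /= ?andbT => xi iU.
- left; exists r; first by case/andP: xi.
  by move=> y xy yr; apply: iU; rewrite /= in_itv /= yr andbT (lt_le_trans _ xy)//; case/andP: xi.
- by right=> y xy; apply: iU; rewrite /= in_itv /= andbT (lt_le_trans xi).
- by left; exists r => // y xy yr; apply: iU; rewrite /= in_itv.
- by right=> y xy; apply: iU; rewrite /= in_itv.
Qed.

(** A property that passes to suprema and a little beyond each point holds
    everywhere: otherwise the supremum of the initial segments on which it holds
    could be exceeded. *)
Lemma real_induction (P : L -> Prop) : complete_order L ->
  (forall x, (forall y, y < x -> P y) -> P x) ->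
  (forall x z, (forall y, y <= x -> P y) -> x < z ->
    exists2 t, x < t & forall y, y <= t -> P y) ->
  forall x, P x.
Proof.
move=> cL step1 step2 x.
have [s [sub slub]] := cL [set x | forall y, y <= x -> P y].
have Ps y : y <= s -> P y.
  have lt z : z < s -> P z by move=> /slub[t Pt /ltW]; exact: Pt.
  by rewrite le_eqVlt => /predU1P[->|/lt//]; exact: step1.
have [/Ps//|sx] := leP x s.
have [t st /sub] := step2 _ _ Ps sx.
by rewrite leNgt st.
Qed.

Hypotheses (cL : complete_order L) (dL : dense_order L).

Lemma dense_nbhs_right x z (U : set L) : nbhs x U -> x < z ->
  exists2 t, x < t & forall y, x <= y -> y <= t -> U y.
Proof.
move=> /nbhs_right[[r xr rU] _|aU xz]; last by exists z => // y xy _; exact: aU.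
have [t xt tr] := dL xr; exists t => // y xy yt.
exact/rU/(le_lt_trans yt).
Qed.

(** Real induction on the segments below [x] in the filter form of compactness. *)
Lemma order_compact : compact [set: L].
Proof.
apply/compact_near_coveringP => I F P FF cover.
have [top [topP _]] := cL setT.
suff Q x : \forall i \near F, forall y, y <= x -> P i y.
  by apply: filterS (Q top) => i + y _; apply; exact: topP.
apply: (real_induction cL (P := fun x => \forall i \near F, forall y, y <= x -> P i y)).
- move=> {}x IH; have [[U V] /= [Ux FV] UV] := cover x Logic.I.
  have [[l lx lU]|aU] := nbhs_left Ux; last first.
    by apply: filterS FV => i Vi y yx; apply: (UV (y, i)); split => //; exact: aU.
  apply: filterS2 FV (IH _ lx) => i Vi il y yx.
  have [/il//|ly] := leP y l.
  by apply: (UV (y, i)); split => //=; exact: lU.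
- move=> {}x z IH xz; have [[U V] /= [Ux FV] UV] := cover x Logic.I.
  have [t xt tU] := dense_nbhs_right Ux xz.
  exists t => // y yt; apply: filterS2 FV (IH _ (lexx x)) => i Vi ix w wy.
  have [/ix//|xw] := leP w x.
  by apply: (UV (w, i)); split=> //=; apply: tU; [exact: ltW|exact: le_trans yt].
Qed.

Lemma locally_constant_const (B : set L) :
  (forall x, \forall y \near x, B y <-> B x) -> forall x y, B x -> B y.
Proof.
move=> loc; have [bot botP] : exists s : L, forall x, s <= x.
  have [s [_ slub]] := cL set0; exists s => x.
  by rewrite leNgt; apply/negP => /slub[].
suff Q x : B x <-> B bot by move=> x y /Q; exact: (Q y).2.
apply: (real_induction cL (P := fun x => B x <-> B bot)).
- move=> {}x IH; have [[l lx lB]|aB] := nbhs_left (loc x); last first.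
    by apply: iff_sym; exact: (aB _ (botP x)).
  have [y ly yx] := dL lx; rewrite -(IH _ yx); by apply: iff_sym; exact: (lB _ ly (ltW yx)).
- move=> {}x z IH xz; have [t xt tB] := dense_nbhs_right (loc x) xz.
  exists t => // y yt; have [/IH//|xy] := leP y x.
  rewrite -(IH _ (lexx x)); apply: tB => //; exact: ltW.
Qed.

Lemma order_connected : connected [set: L].
Proof.
move=> B [b Bb] [U oU BU] [V oV BV]; apply/seteqP; split=> // x _.
rewrite setTI in BU; rewrite setTI in BV.
suff loc : forall x : L, \forall y \near x, B y <-> B x by exact: (locally_constant_const loc) Bb.
apply: clopen_locally_constant.
  by rewrite BU.
by rewrite BV.
Qed.

(** [G] stands for the small sets: if every point has a small neighbourhood, the
    whole order is cut into finitely many small closed segments. *)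
Lemma fine_subdivision (G : set (set L)) bot top :
  (forall x, bot <= x) -> (forall x, x <= top) ->
  (forall A B, G B -> A `<=` B -> G A) ->
  (forall x, exists2 U, nbhs x U & G U) ->
  exists m (s : nat -> L), [/\ s 0%N = bot, s m = top
    & forall j, (j < m)%N -> s j < s j.+1 /\ G [set y | s j <= y <= s j.+1]].
Proof.
move=> botP topP Gs Gn.
pose P x := exists m (s : nat -> L), [/\ s 0%N = bot, s m = x
    & forall j, (j < m)%N -> s j < s j.+1 /\ G [set y | s j <= y <= s j.+1]].
have Padd x y : P x -> x < y -> G [set z | x <= z <= y] -> P y.
  move=> [m [s [s0 sm sj]]] xy Gxy.
  exists m.+1, (fun j => if (j <= m)%N then s j else y); split=> //.
    by rewrite ltnn.
  move=> j; rewrite ltnS leq_eqVlt => /predU1P[->|jm]; first by rewrite eqxx ltnn sm.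
  by rewrite jm orbT; exact: sj.
have Pbot : P bot by exists 0%N, (fun=> bot).
suff Q : forall x, P x by exact: Q.
apply: (real_induction cL).
- move=> x IH; have [U Ux GU] := Gn x.
  have [[l lx lU]|aU] := nbhs_left Ux.
    have [y ly yx] := dL lx.
    apply: (Padd _ _ (IH _ yx) yx); apply: Gs GU _ => z /andP[yz zx].
    by apply: lU => //; exact: lt_le_trans yz.
  have := botP x; rewrite le_eqVlt => /predU1P[<-//|bx].
  by apply: (Padd _ _ Pbot bx); apply: Gs GU _ => z /andP[_ zx]; exact: aU.
- move=> x z IH xz; have [U Ux GU] := Gn x.
  have [t xt tU] := dense_nbhs_right Ux xz.
  exists t => // y yt; have [/IH//|xy] := leP y x.
  apply: (Padd _ _ (IH _ (lexx x)) xy); apply: Gs GU _ => w /andP[xw wy].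
  by apply: tU => //; exact: le_trans yt.
Qed.

End CompleteDenseOrder.

(** Cantor's nested intervals: given an injection [f] into the integers, the n-th
    step shrinks the interval so as to exclude the point of code n. *)
Lemma complete_dense_uncountable d (L : orderType d) : complete_order L -> dense_order L ->
  (exists x y : L, (x < y)%O) -> ~ countable [set: L].
Proof.
move=> cL dL [x [y xy]] /countable_injP[f finj].
have /choice[next nextP] : forall nab : nat * (L * L), exists ab : L * L,
    (nab.2.1 < nab.2.2)%O -> [/\ (nab.2.1 <= ab.1)%O, (ab.1 < ab.2)%O, (ab.2 <= nab.2.2)%O
      & forall e, f e = nab.1 -> ~~ (ab.1 <= e <= ab.2)%O].
  move=> [n [a b]] /=; have [ab|ba] := ltP a b; last by exists (a, b).
  have [[e en]|ne] := pselect (exists e, f e = n); last first.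
    by exists (a, b) => _; split=> // e en; case: ne; exists e.
  have e_uniq e' : f e' = n -> e' = e by rewrite -en; apply: finj; rewrite inE.
  have [c ac cb] := dL _ _ ab; have [c' cc' c'b] := dL _ _ cb.
  have [ec|ce] := leP e c.
    exists (c', b) => _; split=> //=; first by rewrite ltW// (lt_trans ac).
    by move=> e' /e_uniq ->; rewrite (leNgt c') (le_lt_trans ec cc').
  exists (a, c) => _; split=> //=; first exact: ltW.
  by move=> e' /e_uniq ->; rewrite (leNgt e) ce andbF.
pose I := fix I n := if n is m.+1 then next (m, I m) else (x, y).
have Ilt n : ((I n).1 < (I n).2)%O by elim: n => // n /(nextP (n, I n))[].
have Imono m n : (m <= n)%N -> ((I m).1 <= (I n).1)%O /\ ((I n).2 <= (I m).2)%O.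
  move=> /subnK <-; elim: (n - m)%N => [//|j [h1 h2]]; rewrite addSn.
  have [h3 _ h4 _] := nextP (j + m, I (j + m))%N (Ilt _).
  by split; [exact: le_trans h3|exact: le_trans h4 h2].
have [s [sub slub]] := cL [set (I n).1 | n in setT].
have sI n : ((I n).1 <= s <= (I n).2)%O.
  rewrite sub/=; last by exists n.
  rewrite leNgt; apply/negP => /slub[_ [m _ <-]]; apply/negP; rewrite -leNgt.
  have [mn|/ltnW nm] := leqP m n.
    exact: le_trans (Imono _ _ mn).1 (ltW (Ilt n)).
  exact: le_trans (ltW (Ilt m)) (Imono _ _ nm).2.
have [_ _ _ /(_ s erefl)] := nextP (f s, I (f s)) (Ilt _).
by rewrite (sI (f s).+1).
Qed.

(** * Continuity of order-reversing involutions *)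

Section RayContinuity.
Context {d : Order.disp_t} {L : orderTopologicalType d}.
Local Open Scope order_scope.

Lemma continuous_rays (T : topologicalType) (f : T -> L) :
  (forall c, open [set x | f x < c]) -> (forall c, open [set x | c < f x]) ->
  continuous f.
Proof.
move=> fl fr x U; rewrite itv_nbhsE => -[[l r] [io xi] iU].
have nl c : f x < c -> \forall y \near x, f y < c.
  by move=> xc; apply: (open_nbhs_nbhs (A := [set x | f x < c])).
have nr c : c < f x -> \forall y \near x, c < f y.
  by move=> xc; apply: (open_nbhs_nbhs (A := [set x | c < f x])).
case: l io xi iU => [[] l|[]] //; case: r => [[] r|[]] // io;
  rewrite in_itv /= ?andbT => xi iU.
- case/andP: xi => /nr xl /nl xr.
  by apply: filterS2 xl xr => y ly yr; apply: iU; rewrite /= in_itv /= ly.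
- by apply: filterS (nr _ xi) => y ly; apply: iU; rewrite /= in_itv /= ly.
- by apply: filterS (nl _ xi) => y ly; apply: iU; rewrite /= in_itv.
- by apply: filterS filterT => y _; apply: iU; rewrite /= in_itv.
Qed.

(** The involution [r] of the initial segment is extended by a constant, so that
    preimages of rays are rays, empty or full. *)
Lemma left_reversal_continuous (a : L) (r : L -> L) :
  (forall x, x <= a -> r x <= a /\ r (r x) = x) ->
  (forall x y, x < y -> y <= a -> r y < r x) ->
  continuous (fun x => r (Order.min x a)).
Proof.
move=> rI rm.
have ma x : Order.min x a <= a by rewrite ge_min lexx orbT.
have rlt x y : x <= a -> y <= a -> (r x < y) = (r y < x).
  move=> xa ya; apply/idP/idP => lt.
    by have := rm _ _ lt ya; rewrite (rI _ xa).2.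
  by have := rm _ _ lt xa; rewrite (rI _ ya).2.
apply: continuous_rays => c.
- have [ca|ac] := leP c a.
    rewrite (_ : [set _ | _] = if r c < a then `]r c, +oo[%classic else set0).
      by case: ifP => _; [exact: rray_open|exact: open0].
    apply/seteqP; split=> x /=.
      rewrite rlt// lt_min => /andP[cx ->] /=.
      by rewrite in_itv /= cx.
    case: ifPn => // ra; rewrite /= in_itv /= andbT => cx.
    by rewrite rlt// lt_min cx.
  rewrite (_ : [set _ | _] = setT); first exact: openT.
  by apply/seteqP; split=> x //= _; apply: le_lt_trans ac; exact: (rI _ (ma x)).1.
- have [ac|ca] := leP a c.
    rewrite (_ : [set _ | _] = set0); first exact: open0.
    apply/seteqP; split=> x //=; rewrite ltNge => /negP; apply.
    by apply: le_trans ac; exact: (rI _ (ma x)).1.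
  have rgt x : x <= a -> (c < r x) = (x < r c).
    move=> xa; apply/idP/idP => lt.
      by have := rm _ _ lt (rI _ xa).1; rewrite (rI _ xa).2.
    by have := rm _ _ lt (rI _ (ltW ca)).1; rewrite (rI _ (ltW ca)).2.
  rewrite (_ : [set _ | _] = if a < r c then setT else `]-oo, r c[%classic).
    by case: ifP => _; [exact: openT|exact: lray_open].
  apply/seteqP; split=> x /=.
    by rewrite rgt// gt_min; case: (ltP a (r c)) => //= _; rewrite orbF in_itv.
  by rewrite rgt// gt_min; case: (ltP a (r c)) => //= _; [rewrite orbT|rewrite orbF in_itv].
Qed.

Lemma right_reversal_continuous (a : L) (r : L -> L) :
  (forall x, a <= x -> a <= r x /\ r (r x) = x) ->
  (forall x y, x < y -> a <= x -> r y < r x) ->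
  continuous (fun x => r (Order.max x a)).
Proof.
move=> rI rm.
have ma x : a <= Order.max x a by rewrite le_max lexx orbT.
have rlt x y : a <= x -> a <= y -> (x < r y) = (y < r x).
  move=> xa ya; apply/idP/idP => lt.
    by have := rm _ _ lt xa; rewrite (rI _ ya).2.
  by have := rm _ _ lt ya; rewrite (rI _ xa).2.
apply: continuous_rays => c.
- have [ca|ac] := leP c a.
    rewrite (_ : [set _ | _] = set0); first exact: open0.
    apply/seteqP; split=> x //=; rewrite ltNge => /negP; apply.
    by apply: le_trans ca _; exact: (rI _ (ma x)).1.
  have rgt x : a <= x -> (r x < c) = (r c < x).
    move=> xa; apply/idP/idP => lt.
      by have := rm _ _ lt (rI _ xa).1; rewrite (rI _ xa).2.
    by have := rm _ _ lt (rI _ (ltW ac)).1; rewrite (rI _ (ltW ac)).2.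
  rewrite (_ : [set _ | _] = if r c < a then setT else `]r c, +oo[%classic).
    by case: ifP => _; [exact: openT|exact: rray_open].
  apply/seteqP; split=> x /=.
    by rewrite rgt// lt_max; case: (ltP (r c) a) => //= _; rewrite orbF in_itv /= andbT.
  rewrite rgt// lt_max; case: (ltP (r c) a) => //= _; first by rewrite orbT.
- have [ac|ca] := leP a c.
    rewrite (_ : [set _ | _] = if a < r c then `]-oo, r c[%classic else set0).
      by case: ifP => _; [exact: lray_open|exact: open0].
    apply/seteqP; split=> x /=.
      by rewrite rlt// gt_max => /andP[cx ->] /=; rewrite in_itv /= cx.
    case: ifPn => // ra; rewrite /= in_itv /= => cx.
    by rewrite rlt// gt_max cx.
  rewrite (_ : [set _ | _] = setT); first exact: openT.
  by apply/seteqP; split=> x //= _; apply: lt_le_trans ca _; exact: (rI _ (ma x)).1.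
Qed.

End RayContinuity.

(** * Topological preliminaries *)

Section Topology.

Lemma closed_separation (T : topologicalType) (A B : set T) : hausdorff_space T ->
  compact [set: T] -> closed A -> closed B -> A `&` B = set0 ->
  exists U V, [/\ open U, open V, A `<=` U, B `<=` V & U `&` V = set0].
Proof.
move=> hT cT cA cB AB.
have [|W /set_nbhsP[U [oU AU UW]] WB] := compact_normal hT cT cA (t := ~` B).
  apply/set_nbhsP; exists (~` B); split=> //; first exact: closed_openC.
  exact/disjoints_subset.
exists U, (~` closure W); split=> //.
- exact/closed_openC/closed_closure.
- by apply: subsetCr; exact: WB.
- by apply/seteqP; split=> x //= [/UW/subset_closure Wx /(_ Wx)].
Qed.

(** The fibres are disjoint closed sets of a normal space; the complements of the
    images of the complements of their separating neighbourhoods separate the two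
    points. *)
Lemma closed_image_hausdorff (T U : topologicalType) (f : T -> U) :
  hausdorff_space T -> compact [set: T] -> (forall y, exists x, f x = y) ->
  continuous f -> (forall A, closed A -> closed (f @` A)) -> hausdorff_space U.
Proof.
move=> hT cT fs fc fcl; rewrite open_hausdorff => y z yz.
have cfib w : closed (f @^-1` [set w]).
  move/continuous_closedP: fc; apply.
  have [x <-] := fs w; rewrite -image_set1; apply: fcl.
  exact/accessible_closed_set1/hausdorff_accessible.
have [|V [W [oV oW yV zW VW]]] := closed_separation hT cT (cfib y) (cfib z).
  by apply/seteqP; split=> x //= [fy fz]; rewrite -fy -fz eqxx in yz.
exists (~` (f @` (~` V)), ~` (f @` (~` W))).
  split; rewrite inE /=.
    by move=> [x nV fx]; apply/nV/yV.
  by move=> [x nW fx]; apply/nW/zW.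
split; [exact/closed_openC/fcl/open_closedC..|].
apply/eqP/seteqP; split=> w //= [nV nW]; have [x fx] := fs w.
have Vx : V x by apply: contrapT => h; apply: nV; exists x.
have Wx : W x by apply: contrapT => h; apply: nW; exists x.
by have : (V `&` W) x by []; rewrite VW.
Qed.

(** Finitely many closed sets are enlarged to open sets without creating new
    intersections: each disjoint pair is separated by normality, and the
    finitely many resulting neighbourhoods are intersected. *)
Lemma swelling (T : topologicalType) (t : nat) (K V : 'I_t -> set T) :
  hausdorff_space T -> compact [set: T] ->
  (forall i, closed (K i)) -> (forall i, open (V i)) -> (forall i, K i `<=` V i) ->
  exists U : 'I_t -> set T, [/\ forall i, open (U i), forall i, K i `<=` U i,
    forall i, U i `<=` V i & forall i j, K i `&` K j = set0 -> U i `&` U j = set0].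
Proof.
move=> hT cT cK oV KV.
have /choice[N NP] : forall ij : 'I_t * 'I_t, exists N : set T * set T,
    [/\ open N.1, open N.2, K ij.1 `<=` N.1, K ij.2 `<=` N.2
      & K ij.1 `&` K ij.2 = set0 -> N.1 `&` N.2 = set0].
  move=> [i j] /=; have [e|] := pselect (K i `&` K j = set0); last first.
    by move=> ne; exists (setT, setT); split=> //; exact: openT.
  have [A [B [oA oB KA KB AB]]] := closed_separation hT cT (cK i) (cK j) e.
  by exists (A, B).
exists (fun i => V i `&` [set x | forall j, (N (i, j)).1 x /\ (N (j, i)).2 x]).
split.
- move=> i; apply: openI => //; rewrite openE => x /= xN.
  apply: filter_forall => j; apply: open_nbhs_nbhs; split; last exact: xN.
  by apply: openI; [case: (NP (i, j))|case: (NP (j, i))].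
- move=> i x Kx; split; first exact: KV.
  by move=> j; case: (NP (i, j)) (NP (j, i)) => _ _ /(_ x Kx) h1 _ _ [_ _ _ /(_ x Kx)].
- by move=> i x [].
- move=> i j Kij; apply/seteqP; split=> x //= [[_ /(_ j)[N1 _]] [_ /(_ i)[_ N2]]].
  have : ((N (i, j)).1 `&` (N (i, j)).2) x by [].
  by case: (NP (i, j)) => _ _ _ _ ->.
Qed.

Lemma cvg_initial (A : choiceType) (T : topologicalType) (f : A -> T)
    (G : set_system (initial_topology f)) (a : initial_topology f) :
  Filter G -> f @ G --> f a -> G --> a.
Proof.
move=> FG fG U; rewrite /= (@nbhsE (initial_topology f)) => -[V [[W oW <-] Wa] VU].
by apply: filterS VU _; apply: fG; exact: open_nbhs_nbhs.
Qed.

Lemma homeomorphism_comp (T : topologicalType) (f g : T -> T) :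
  homeomorphism f -> homeomorphism g -> homeomorphism (g \o f).
Proof.
move=> [fc [f' [f'c fK f'K]]] [gc [g' [g'c gK g'K]]]; split.
  by move=> x; apply: continuous_comp; [exact: fc|exact: gc].
exists (f' \o g'); split; [|exact: can_comp|exact: can_comp].
by move=> x; apply: continuous_comp; [exact: g'c|exact: f'c].
Qed.

Lemma homeomorphism_inv (T : topologicalType) (f : T -> T) x y :
  homeomorphism f -> f x = y -> exists2 g, homeomorphism g & g y = x.
Proof.
move=> [fc [g [gc fK gK]]] <-; exists g; last exact: fK.
by split=> //; exists f.
Qed.

(** Each member contains a nonempty set of a countable basis, and disjointness
    makes this choice injective. *)
Lemma metrizable_countable_cellularity (T : topologicalType) (I : Type) (O : I -> set T) :
  compact [set: T] -> metrizable T -> (forall i, open (O i)) -> (forall i, O i !=set0) ->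
  (forall i j x, O i x -> O j x -> i = j) -> countable [set: I].
Proof.
move=> cT [R [M [h [hc [g [gc hK gK]]]]]] oO neO dO.
have [i0|nI] := pselect (exists i : I, True); last first.
  rewrite (_ : [set: I] = set0); first exact: countable0.
  by apply/seteqP; split=> // i _; apply: nI; exists i.
have [x0 _] : exists x : T, True.
  by case: i0 => i _; have [x _] := neO i; exists x.
(* The theorem on second countability is about pointed spaces. *)
pose M' : pseudoPMetricType R := HB.pack (M : Type) (PseudoMetric.on M) (isPointed.Build M (h x0)).
have cM : compact [set: M'].
  rewrite (_ : [set: M'] = h @` setT).
    by apply: continuous_compact => //; exact: continuous_subspaceT.
  by apply/seteqP; split=> // y _; exists (g y).
have [B cB [oB Bbasis]] := compact_second_countable cM.
have /choice[b bP] : forall i, exists V, [/\ B V, V !=set0 & V `<=` g @^-1` (O i)].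
  move=> i; have [x Ox] := neO i.
  have oOg : open (g @^-1` (O i) : set M') by apply: open_comp => //; move=> y _; exact: gc.
  have [V [BV Vx] VO] : filter_from [set U | B U /\ U (h x)] id (g @^-1` (O i)).
    by apply: Bbasis; apply: open_nbhs_nbhs; split=> //=; rewrite hK.
  by exists V; split=> //; exists (h x).
move: cB => /countable_injP[f finj]; apply/countable_injP; exists (f \o b).
move=> i j _ _ /= fij.
have bij : b i = b j by apply: finj => //; rewrite inE; [case: (bP i)|case: (bP j)].
have [_ [y biy] bO] := bP i; have [_ _ bO'] := bP j.
by apply: (dO i j (g y)); [exact: bO|apply: bO'; rewrite -bij].
Qed.

End Topology.

(** * Cyclic indices *)

Section OrdinalArithmetic.

Lemma mod_ordS m n (i : 'I_(m * n)) : mod_ord (ordS i) = ordS (mod_ord i).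
Proof.
apply: val_inj; rewrite /= modn_dvdm ?dvdn_mull//.
by rewrite -(addn1 (i %% n)) modnDml addn1.
Qed.

Lemma mod_ord_rev m n (i : 'I_(m * n)) : mod_ord (rev_ord i) = rev_ord (mod_ord i).
Proof.
apply: val_inj => /=.
have n0 : (0 < n)%N by case: n i => [|//] i; case: i; rewrite muln0.
have qm : (i %/ n < m)%N by rewrite ltn_divLR.
have rn : (i %% n < n)%N by rewrite ltn_pmod.
have -> : (m * n - i.+1 = (m - (i %/ n).+1) * n + (n - (i %% n).+1))%N.
  rewrite {1}(divn_eq i n) mulnBl.
  have : ((i %/ n).+1 * n <= m * n)%N by rewrite leq_mul2r qm orbT.
  by rewrite mulSn; lia.
by rewrite modnMDl modn_small// ltn_subrL n0.
Qed.

Lemma ordS_rev_ordS n (i : 'I_n) : ordS (rev_ord (ordS i)) = rev_ord i.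
Proof.
apply: val_inj => /=; case: i => i /= lt.
have := lt; rewrite leq_eqVlt => /predU1P[<-|lt'].
  by rewrite modnn subn1 subnn prednK// modnn.
by rewrite (modn_small lt') subnSK// modn_small// ltn_subrL /=; lia.
Qed.

End OrdinalArithmetic.

(** * Circles and their coverings *)

Section Circles.
Context {d : Order.disp_t} {L : orderTopologicalType d} (bot top : L).
Hypotheses (botP : forall x, (bot <= x)%O) (topP : forall x, (x <= top)%O).
Hypothesis bot_top : bot != top.

Definition pt n (i : 'I_n) (x : L) : circle L n :=
  circle_proj (existT (fun=> L) i x : copies L n).

Definition end_of n (i : 'I_n) (x : L) : option 'I_n :=
  end_index (existT (fun=> L) i x : copies L n).

Lemma is_firstE x : `[< is_first x >] = (x == bot).
Proof.
apply/asboolP/eqP => [fx|->]; last exact: botP.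
by apply/eqP; rewrite eq_le fx botP.
Qed.

Lemma is_lastE x : `[< is_last x >] = (x == top).
Proof.
apply/asboolP/eqP => [lx|->]; last exact: topP.
by apply/eqP; rewrite eq_le lx topP.
Qed.

Lemma end_ofE n (i : 'I_n) x :
  end_of i x = if x == bot then Some i else if x == top then Some (ordS i) else None.
Proof. by rewrite /end_of /end_index /= is_firstE is_lastE. Qed.

Lemma end_ofP n (i k : 'I_n) x : end_of i x = Some k ->
  (x = bot /\ k = i) \/ (x = top /\ k = ordS i).
Proof.
rewrite end_ofE; case: eqP => [-> [<-]|_]; first by left.
by case: eqP => // -> [<-]; right.
Qed.

Lemma pt_eqP n (i j : 'I_n) x y : pt i x = pt j y <->
  (i = j /\ x = y) \/ (exists2 k, end_of i x = Some k & end_of j y = Some k).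
Proof.
split=> [/circle_projP/orP[/eqP e|]|[[-> ->]//|[k ik jk]]].
- left; split; first by case: e.
  exact: (congr1 (fun u : copies L n => tagged u) e).
- rewrite -/(end_of i x) -/(end_of j y) => /andP[ix /eqP e].
  by right; case: (end_of i x) ix e => // k _ e; exists k.
- by apply/circle_projP/orP; right; rewrite -/(end_of i x) -/(end_of j y) ik jk eqxx.
Qed.

Lemma pt_glue n (i : 'I_n) : pt i top = pt (ordS i) bot.
Proof.
apply/pt_eqP; right; exists (ordS i); rewrite end_ofE ?eqxx//.
by rewrite eq_sym (negbTE bot_top).
Qed.

Lemma pt_same n (i j : 'I_n) x : pt i x = pt j x -> i = j.
Proof.
move=> /pt_eqP[[]//|[k /end_ofP ik /end_ofP jk]].
case: ik jk => -[-> ->] [] [xb] //.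
- by move: bot_top; rewrite xb eqxx.
- by move: bot_top; rewrite -xb eqxx.
- exact: (can_inj (@ordSK n)).
Qed.

Lemma ptP n (z : circle L n) : exists i x, z = pt i x.
Proof.
exists (tag (repr z)), (tagged (repr z)).
by rewrite /pt -[LHS]reprK /circle_proj; case: (repr z).
Qed.

(** A function that respects the gluing takes at any representative of an end
    point the same value as at the first point of the copy that starts there. *)
Lemma end_val n (Z : Type) (g : 'I_n -> L -> Z) (i k : 'I_n) x :
  (forall i, g i top = g (ordS i) bot) -> end_of i x = Some k -> g i x = g k bot.
Proof. by move=> gg /end_ofP[[-> ->]//|[-> ->]]. Qed.

Definition circle_lift n (Z : Type) (g : 'I_n -> L -> Z) (z : circle L n) : Z :=
  g (tag (repr z)) (tagged (repr z)).

Lemma circle_liftE n (Z : Type) (g : 'I_n -> L -> Z) i x :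
  (forall i, g i top = g (ordS i) bot) -> circle_lift g (pt i x) = g i x.
Proof.
move=> gg; have : pt (tag (repr (pt i x))) (tagged (repr (pt i x))) = pt i x.
  by rewrite -[RHS]reprK /pt /circle_proj; case: (repr _).
rewrite /circle_lift => /pt_eqP[[-> ->]//|[k h1 h2]].
by rewrite (end_val gg h1) (end_val gg h2).
Qed.

Lemma circle_openP n (U : set (circle L n)) :
  open U <-> forall i, open [set x | U (pt i x)].
Proof. exact: sigT_openP. Qed.

Lemma circle_closedP n (U : set (circle L n)) :
  closed U <-> forall i, closed [set x | U (pt i x)].
Proof.
rewrite -openC circle_openP; split=> h i; first by rewrite -openC; exact: h.
by have := h i; rewrite -openC.
Qed.

Lemma pt_continuous n (i : 'I_n) : continuous (pt i).
Proof. by apply/continuousP => A /circle_openP/(_ i). Qed.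

Lemma circle_lift_continuous n (Z : topologicalType) (g : 'I_n -> L -> Z) :
  (forall i, g i top = g (ordS i) bot) -> (forall i, continuous (g i)) ->
  continuous (circle_lift g).
Proof.
move=> gg gc; apply/continuousP => A oA; apply/circle_openP => i.
rewrite (_ : [set x | _] = g i @^-1` A); first by move/continuousP: (gc i); apply.
by apply/seteqP; split=> x; rewrite /= circle_liftE.
Qed.

Lemma covering_pt m n (i : 'I_(m * n)) x : covering_map (pt i x) = pt (mod_ord i) x.
Proof. exact: covering_mapE. Qed.

Lemma covering_continuous m n : continuous (@covering_map d L m n).
Proof.
apply/continuousP => A /circle_openP oA; apply/circle_openP => i.
rewrite (_ : [set x | _] = [set x | A (pt (mod_ord i) x)]); first exact: oA.
by apply/seteqP; split=> x; rewrite /= covering_pt.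
Qed.

(** * Rotations and tower symmetries *)

Definition shift n : circle L n -> circle L n := circle_lift (fun i x => pt (ordS i) x).
Definition unshift n : circle L n -> circle L n :=
  circle_lift (fun i x => pt (ord_pred i) x).

Lemma shift_pt n (i : 'I_n) x : shift (pt i x) = pt (ordS i) x.
Proof. by rewrite /shift circle_liftE// => j; exact: pt_glue. Qed.

Let unshift_glue n (i : 'I_n) : pt (ord_pred i) top = pt (ord_pred (ordS i)) bot.
Proof. by rewrite pt_glue ord_predK ordSK. Qed.

Lemma unshift_pt n (i : 'I_n) x : unshift (pt i x) = pt (ord_pred i) x.
Proof. by rewrite /unshift circle_liftE// => j; exact: unshift_glue. Qed.

Lemma shiftK n : cancel (@shift n) (@unshift n).
Proof. by move=> z; have [i [x ->]] := ptP z; rewrite shift_pt unshift_pt ordSK. Qed.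

Lemma unshiftK n : cancel (@unshift n) (@shift n).
Proof. by move=> z; have [i [x ->]] := ptP z; rewrite unshift_pt shift_pt ord_predK. Qed.

Lemma shift_continuous n : continuous (@shift n).
Proof.
apply: circle_lift_continuous => i; [exact: pt_glue|exact: pt_continuous].
Qed.

Lemma unshift_continuous n : continuous (@unshift n).
Proof.
apply: circle_lift_continuous => i; [exact: unshift_glue|exact: pt_continuous].
Qed.

Lemma covering_shift m n (z : circle L (m * n)) :
  covering_map (shift z) = shift (covering_map z).
Proof.
by have [i [x ->]] := ptP z; rewrite shift_pt !covering_pt shift_pt mod_ordS.
Qed.

Lemma val_iter_ordS n c (i : 'I_n) : val (iter c (@ordS n) i) = ((i + c) %% n)%N.
Proof.
elim: c => [|c IH]; first by rewrite addn0 modn_small.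
by rewrite iterS /= IH -addn1 modnDml addn1 addnS.
Qed.

Lemma iter_shift_pt n c (i : 'I_n) x : iter c (@shift n) (pt i x) = pt (iter c (@ordS n) i) x.
Proof. by elim: c => // c IH; rewrite !iterS IH shift_pt. Qed.

Lemma iter_shift_mod n c c' (z : circle L n) : c = c' %[mod n] ->
  iter c (@shift n) z = iter c' (@shift n) z.
Proof.
move=> cc'; have [i [x ->]] := ptP z; rewrite !iter_shift_pt; congr pt.
by apply: val_inj; rewrite !val_iter_ordS -modnDmr cc' modnDmr.
Qed.

(** A homeomorphism of every circle, commuting with all the coverings; along the
    bonding maps it induces a homeomorphism of the inverse limit. *)
Definition tower_symmetry (h : forall n, circle L n -> circle L n) :=
  exists g : forall n, circle L n -> circle L n,
  (forall n, [/\ continuous (h n), continuous (g n), cancel (h n) (g n) & cancel (g n) (h n)]) /\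
  forall m n (z : circle L (m * n)), covering_map (h (m * n)%N z) = h n (covering_map z).

Lemma tower_symmetry_comp h h' : tower_symmetry h -> tower_symmetry h' ->
  tower_symmetry (fun n => h n \o h' n).
Proof.
move=> [g [hP hc]] [g' [h'P h'c]]; exists (fun n => g' n \o g n); split.
  move=> n; have [c1 c2 k1 k2] := hP n; have [c1' c2' k1' k2'] := h'P n.
  split; [| |exact: can_comp|exact: can_comp].
    by move=> z; apply: continuous_comp; [exact: c1'|exact: c1].
  by move=> z; apply: continuous_comp; [exact: c2|exact: c2'].
by move=> m n z; rewrite /= hc h'c.
Qed.

Lemma tower_symmetry_id : tower_symmetry (fun n => id).
Proof. by exists (fun n => id); split=> // n; split=> // z. Qed.

Lemma tower_symmetry_shift c : tower_symmetry (fun n => iter c (@shift n)).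
Proof.
elim: c => [|c IH]; first exact: tower_symmetry_id.
apply: (@tower_symmetry_comp (@shift)) IH.
exists (@unshift); split=> [n|m n z]; last exact: covering_shift.
by split; [exact: shift_continuous|exact: unshift_continuous|exact: shiftK|exact: unshiftK].
Qed.

(** * Reflections *)

(** [l] and [r] reverse the segments on the left and on the right of [a].  The
    reflection reverses the cyclic order of the copies; as the part of a copy
    before [a] stays adjacent to the first point of this copy, the two parts go
    to different copies: [rev_ord i] stands for the index - i - 1, and its
    successor for - i. *)
Section Reflection.
Variables (a : L) (l r : L -> L).
Hypotheses (botNa : bot != a) (aNtop : a != top).
Hypotheses (lI : forall x, (x <= a)%O -> (l x <= a)%O /\ l (l x) = x)
  (lm : forall x y, (x < y)%O -> (y <= a)%O -> (l y < l x)%O)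
  (rI : forall x, (a <= x)%O -> (a <= r x)%O /\ r (r x) = x)
  (rm : forall x y, (x < y)%O -> (a <= x)%O -> (r y < r x)%O).

Let l_bot : l bot = a.
Proof.
apply/eqP; rewrite eq_le (lI (botP a)).1 /= leNgt; apply/negP => lt.
have [la lla] := lI (lexx a).
by have := lm lt (lexx a); rewrite (lI (botP a)).2 ltNge botP.
Qed.

Let l_a : l a = bot. Proof. by rewrite -l_bot (lI (botP a)).2. Qed.

Let r_top : r top = a.
Proof.
apply/eqP; rewrite eq_le (rI (topP a)).1 andbT leNgt; apply/negP => lt.
by have := rm lt (lexx a); rewrite (rI (topP a)).2 ltNge topP.
Qed.

Let r_a : r a = top. Proof. by rewrite -r_top (rI (topP a)).2. Qed.

Definition refl_fun n (i : 'I_n) (x : L) : circle L n :=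
  if (x <= a)%O then pt (ordS (rev_ord i)) (l x) else pt (rev_ord i) (r x).

Let top_a : (top <= a)%O = false.
Proof. by apply/negbTE; rewrite -ltNge lt_neqAle aNtop topP. Qed.

Lemma refl_fun_right n (i : 'I_n) x : (a <= x)%O -> refl_fun i x = pt (rev_ord i) (r x).
Proof.
move=> ax; rewrite /refl_fun; case: leP => // xa.
have -> : x = a by apply/eqP; rewrite eq_le xa.
by rewrite l_a r_a pt_glue.
Qed.

Lemma refl_glue n (i : 'I_n) : refl_fun i top = refl_fun (ordS i) bot.
Proof. by rewrite /refl_fun top_a botP l_bot r_top ordS_rev_ordS. Qed.

Lemma refl_fun_continuous n (i : 'I_n) : continuous (refl_fun i).
Proof.
have lc := left_reversal_continuous lI lm.
have rc := right_reversal_continuous rI rm.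
pose f1 x := pt (ordS (rev_ord i)) (l (Order.min x a)).
pose f2 x := pt (rev_ord i) (r (Order.max x a)).
have c1 : continuous f1.
  by move=> x; apply: continuous_comp; [exact: lc|exact: pt_continuous].
have c2 : continuous f2.
  by move=> x; apply: continuous_comp; [exact: rc|exact: pt_continuous].
have e1 x : (x <= a)%O -> refl_fun i x = f1 x.
  by move=> xa; rewrite /refl_fun /f1 xa min_l.
have e2 x : (a <= x)%O -> refl_fun i x = f2 x.
  by move=> ax; rewrite refl_fun_right// /f2 max_l.
move=> x U; case: (ltgtP x a) => [xa|ax|->].
- rewrite e1 ?(ltW xa)// => /c1 fU.
  have xn : nbhs x `]-oo, a[%classic.
    by apply: open_nbhs_nbhs; split; [exact: lray_open|rewrite /= in_itv].
  apply: filterS2 xn fU => y /=; rewrite in_itv /= => ya; by rewrite e1// ltW.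
- rewrite e2 ?(ltW ax)// => /c2 fU.
  have xn : nbhs x `]a, +oo[%classic.
    by apply: open_nbhs_nbhs; split; [exact: rray_open|rewrite /= in_itv /= ax].
  apply: filterS2 xn fU => y /=; rewrite in_itv /= andbT => ya; by rewrite e2// ltW.
- move=> aU; have aU1 : nbhs (f1 a) U by rewrite -e1.
  have aU2 : nbhs (f2 a) U by rewrite -e2.
  have h1 : \forall y \near a, U (f1 y) by exact: c1.
  have h2 : \forall y \near a, U (f2 y) by exact: c2.
  apply: filterS2 h1 h2 => y /= y1 y2.
  by case/orP: (le_total y a) => ya; [rewrite e1|rewrite e2].
Qed.

Definition reflection n : circle L n -> circle L n := circle_lift (@refl_fun n).

Lemma reflection_pt n (i : 'I_n) x : reflection (pt i x) = refl_fun i x.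
Proof. by rewrite /reflection circle_liftE// => j; exact: refl_glue. Qed.

Lemma reflectionK n : involutive (@reflection n).
Proof.
move=> z; have [i [x ->]] := ptP z; rewrite reflection_pt /refl_fun.
case: leP => [xa|/ltW ax].
  rewrite reflection_pt /refl_fun (lI xa).1 (lI xa).2.
  have -> // : ordS (rev_ord (ordS (rev_ord i))) = i by rewrite ordS_rev_ordS rev_ordK.
by rewrite reflection_pt refl_fun_right ?(rI ax).1// (rI ax).2 rev_ordK.
Qed.

Lemma tower_symmetry_reflection : tower_symmetry (@reflection).
Proof.
exists (@reflection); split=> [n|m n z].
  have rc : continuous (@reflection n).
    by apply: circle_lift_continuous; [exact: refl_glue|exact: refl_fun_continuous].
  by split=> //; exact: reflectionK.
have [i [x ->]] := ptP z; rewrite covering_pt !reflection_pt /refl_fun.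
by case: ifP => _; rewrite covering_pt ?mod_ordS mod_ord_rev.
Qed.

Lemma reflection_center n (i : 'I_n) : reflection (pt i a) = pt (ordS (rev_ord i)) bot.
Proof. by rewrite reflection_pt /refl_fun lexx l_a. Qed.

End Reflection.

(** * The topology of a circle *)

(** Saturating a closed set only adds end points, of which there are finitely
    many. *)
Lemma circle_proj_closed n (C : set (copies L n)) : closed C ->
  closed (@circle_proj d L n @` C).
Proof.
move=> cC; apply/circle_closedP => i.
pose E := [set x | x = bot \/ x = top] `&` [set x | (@circle_proj d L n @` C) (pt i x)].
have cE : closed E.
  have T1 : accessible_space L by apply: hausdorff_accessible; exact: order_hausdorff.
  move/accessible_finite_set_closed: T1; apply.
  apply: (@sub_finite_set _ _ [set bot; top]); last exact: finite_set2.
  by move=> x [].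
rewrite (_ : [set x | _] = [set x | C (existT (fun=> L) i x)] `|` E).
  apply: closedU => //.
  by move/continuous_closedP: (@existT_continuous _ (fun=> L) i); apply.
apply/seteqP; split=> x /=; last first.
  by case=> [Cx|[]//]; exists (existT _ i x).
move=> h; have [[j y] Cy e] := h.
have /pt_eqP[[ji <-]|[k _ /end_ofP kx]] : pt j y = pt i x by exact: e.
  by left; rewrite -ji.
by right; split=> //; case: kx => -[]; [left|right].
Qed.

Hypotheses (cL : complete_order L) (dL : dense_order L).

Lemma circle_compact n : compact [set: circle L n].
Proof.
have -> : [set: circle L n] = @circle_proj d L n @` setT.
  by apply/seteqP; split=> // z _; have [i [x ->]] := ptP z; exists (existT _ i x).
apply: continuous_compact.
  by apply: continuous_subspaceT; exact: pi_continuous.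
by apply: sigT_compact => [|i]; [exact: finite_finset|exact: order_compact].
Qed.

Lemma circle_hausdorff n : hausdorff_space (circle L n).
Proof.
apply: (@closed_image_hausdorff (copies L n) _ (@circle_proj d L n)).
- by apply: sigT_hausdorff => i; exact: order_hausdorff.
- by apply: sigT_compact => [|i]; [exact: finite_finset|exact: order_compact].
- by move=> z; have [i [x ->]] := ptP z; exists (existT _ i x).
- exact: pi_continuous.
- exact: circle_proj_closed.
Qed.

(** A clopen set contains a whole copy as soon as it meets it, hence also the next
    copy, which shares a point with it. *)
Lemma circle_connected n : connected [set: circle L n].
Proof.
move=> B [b Bb] [U oU BU] [V cV BV]; rewrite setTI in BU; rewrite setTI in BV.
have lc i x y : B (pt i x) -> B (pt i y).
  apply: (locally_constant_const cL dL (B := fun x => B (pt i x))).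
  apply: clopen_locally_constant.
    by rewrite BU in oU *; move/circle_openP: oU; apply.
  by rewrite BV in cV *; move/circle_closedP: cV; apply.
have [i [x bE]] := ptP b.
apply/seteqP; split=> // z _; have [j [y ->]] := ptP z.
have Bi c : B (pt (iter c (@ordS n) i) bot).
  elim: c => [|c IH]; first by apply: (lc i x); rewrite -bE.
  by rewrite iterS -pt_glue; exact: lc IH.
have -> : j = iter (n - i + j)%N (@ordS n) i.
  apply: val_inj; rewrite val_iter_ordS addnA subnKC ?(ltnW (ltn_ord i))//.
  by rewrite modnDl modn_small.
exact: lc (Bi _).
Qed.

(** * Sheets of a covering *)

(** Off the fibre of the end point of index 0, the [m]-fold covering of the circle
    made of [n] copies splits into the sheets formed by the copies of indices
    [c * n], ..., [c * n + n - 1]. *)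
Section Sheets.
Variables (m n : nat).

Definition in_sheet c (i : 'I_(m * n)) (x : L) :=
  (i %/ n)%N = c /\ forall k, end_of i x = Some k -> (k %% n)%N <> 0%N.

Lemma in_sheet_end c (i k : 'I_(m * n)) x : in_sheet c i x -> end_of i x = Some k ->
  (k %/ n)%N = c.
Proof.
move=> [ic h] ik; have := h k ik; case: (end_ofP ik) => -[_ ->] //= kn.
have n0 : (0 < n)%N by case: n i {h ik kn ic x k} => [|//] i; case: i; rewrite muln0.
have := ltn_ord i; rewrite leq_eqVlt => /predU1P[e|lt].
  by move: kn; rewrite e modnn mod0n.
rewrite -ic (modn_small lt); rewrite (modn_small lt) in kn.
rewrite {1}(divn_eq i n) -addnS divnMDl// [X in (_ + X)%N]divn_small ?addn0//.
have : (i %% n < n)%N by rewrite ltn_pmod.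
rewrite leq_eqVlt => /predU1P[e|//]; exfalso; apply: kn.
by rewrite {1}(divn_eq i n) -addnS e modnMDl modnn.
Qed.

Lemma in_sheet_pt c (i j : 'I_(m * n)) x y : pt i x = pt j y ->
  in_sheet c i x -> in_sheet c j y.
Proof.
move=> /pt_eqP[[<- <-]//|[k ik jk]] ic.
have kc := in_sheet_end ic ik; have kn := ic.2 k ik.
have jy : in_sheet (j %/ n)%N j y by split=> // l; rewrite jk => -[<-].
by rewrite -kc (in_sheet_end jy jk).
Qed.

Definition sheet c : set (circle L (m * n)) :=
  [set z | exists i x, z = pt i x /\ in_sheet c i x].

Lemma sheet_pt c (i : 'I_(m * n)) x : sheet c (pt i x) <-> in_sheet c i x.
Proof.
split=> [[j [y [e jy]]]|ix]; last by exists i, x.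
by apply: in_sheet_pt jy.
Qed.

Lemma sheet_open c : open (sheet c).
Proof.
apply/circle_openP => i.
have o1 : open [set x : L | bot < x]%O.
  rewrite (_ : [set _ | _] = `]bot, +oo[%classic); first exact: rray_open.
  by apply/seteqP; split=> x /=; rewrite in_itv /= andbT.
have o2 : open [set x : L | x < top]%O.
  rewrite (_ : [set _ | _] = `]-oo, top[%classic); first exact: lray_open.
  by apply/seteqP; split=> x /=; rewrite in_itv.
pose A := [set x : L | ((i %% n)%N = 0%N -> bot < x)%O].
pose B := [set x : L | ((ordS i %% n)%N = 0%N -> x < top)%O].
have oA : open A.
  have [e|ne] := pselect ((i %% n)%N = 0%N); last first.
    by rewrite (_ : A = setT); [exact: openT|apply/seteqP; split=> x // _ /ne].
  by rewrite (_ : A = [set x | bot < x]%O)//; apply/seteqP; split=> [x /(_ e)|x xb _].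
have oB : open B.
  have [e|ne] := pselect ((ordS i %% n)%N = 0%N); last first.
    by rewrite (_ : B = setT); [exact: openT|apply/seteqP; split=> x // _ /ne].
  by rewrite (_ : B = [set x | x < top]%O)//; apply/seteqP; split=> [x /(_ e)|x xb _].
rewrite (_ : [set x | _] = if (i %/ n)%N == c then A `&` B else set0).
  by case: ifP => _; [exact: openI|exact: open0].
apply/seteqP; split=> x /=.
  move=> /sheet_pt[-> h]; rewrite eqxx; split=> /= e.
    rewrite lt_neqAle botP andbT; apply/eqP => xb.
    by apply: (h i) => //; rewrite end_ofE xb eqxx.
  rewrite lt_neqAle topP andbT; apply/eqP => xb.
  by apply: (h (ordS i)) => //; rewrite end_ofE xb eq_sym (negbTE bot_top) eqxx.
case: eqP => // ic [Ax Bx]; apply/sheet_pt; split=> // k /end_ofP[[xb ->]|[xt ->]] e.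
  by have := Ax e; rewrite xb ltxx.
by have := Bx e; rewrite xt ltxx.
Qed.

Lemma covering_injective_on_sheet c (z w : circle L (m * n)) : sheet c z -> sheet c w ->
  covering_map z = covering_map w -> z = w.
Proof.
have [i [x ->]] := ptP z; have [j [y ->]] := ptP w.
move=> /sheet_pt ix /sheet_pt jy; rewrite !covering_pt => /pt_eqP[[e xy]|[k]].
  rewrite xy; congr pt; apply: val_inj; rewrite /= (divn_eq i n) (divn_eq j n).
  by rewrite ix.1 jy.1; congr (_ + _)%N; exact: (congr1 val e).
have end_mod (i' : 'I_(m * n)) (x' : L) :
    end_of (mod_ord i') x' = omap (@mod_ord m n) (end_of i' x').
  exact: (end_index_mod (existT (fun=> L) i' x' : copies L (m * n))).
rewrite !end_mod; case ex : (end_of i x) => [k1|]//= [e1].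
case ey : (end_of j y) => [k2|]//= [e2].
apply/pt_eqP; right; exists k1 => //; rewrite ey; congr Some; apply: val_inj.
rewrite /= (divn_eq k2 n) (divn_eq k1 n) (in_sheet_end ix ex) (in_sheet_end jy ey).
by congr (_ + _)%N; have := congr1 val e1; rewrite -e2.
Qed.

Lemma covering_injective_of_connected (k : 'I_n) (B : set (circle L (m * n))) :
  k = 0%N :> nat -> connected B -> (forall z, B z -> covering_map z <> pt k bot) ->
  forall z w, B z -> B w -> covering_map z = covering_map w -> z = w.
Proof.
move=> k0 cB Bo z w Bz Bw.
have Bsheet u : B u -> exists c, sheet c u.
  move=> Bu; have [i [x uE]] := ptP u; exists (i %/ n)%N; rewrite uE; apply/sheet_pt.
  split=> // l il l0; apply: (Bo u Bu); rewrite uE covering_pt.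
  rewrite (end_val (g := fun i x => pt (mod_ord i) x) _ il) => [|j].
    by congr pt; apply: val_inj; rewrite /= l0 k0.
  by rewrite mod_ordS pt_glue.
have [c zc] := Bsheet z Bz.
have sheet_uniq c1 c2 u : sheet c1 u -> sheet c2 u -> c1 = c2.
  by have [i [x ->]] := ptP u => /sheet_pt[<- _] /sheet_pt[].
have BE : B `&` sheet c = B.
  apply: cB; first by exists z.
    by exists (sheet c) => //; exact: sheet_open.
  exists (~` \bigcup_(c' in [set c' | c' <> c]) sheet c').
    by apply/open_closedC/bigcup_open => c' _; exact: sheet_open.
  apply/seteqP; split=> u /= [Bu].
    move=> uc; split=> // -[c' /= c'c uc']; apply: c'c; exact: sheet_uniq uc' uc.
  move=> h; split=> //; have [c' uc'] := Bsheet u Bu.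
  have [<-//|ne] := pselect (c' = c).
  by exfalso; apply: h; exists c'.
have wc : sheet c w by move: Bw; rewrite -{1}BE => -[].
exact: covering_injective_on_sheet zc wc.
Qed.

End Sheets.

(** * Circular chains of arcs *)

(** Every one of the [n] copies is cut at the same points [s 0], ..., [s m]; the
    arc of index [q * m + r] is the segment from [s r] to [s r.+1] of the q-th
    copy. *)
Section ClosedChain.
Variables (n m : nat) (s : nat -> L).
Hypotheses (m0 : (0 < m)%N) (s0 : s 0%N = bot) (sm : s m = top)
  (sS : forall j, (j < m)%N -> (s j < s j.+1)%O).

Let s_lt a b : (a < b)%N -> (b <= m)%N -> (s a < s b)%O.
Proof.
elim: b => // b IH; rewrite ltnS leq_eqVlt => /predU1P[->|ab] bm; first exact: sS.
exact: lt_trans (IH ab (ltnW bm)) (sS bm).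
Qed.

Lemma copy_subproof (i : 'I_(n * m)) : (i %/ m < n)%N.
Proof. by rewrite ltn_divLR. Qed.

Definition copy_of (i : 'I_(n * m)) : 'I_n := Ordinal (copy_subproof i).

Definition arc (i : 'I_(n * m)) : set (circle L n) :=
  pt (copy_of i) @` [set x | s (i %% m)%N <= x <= s (i %% m)%N.+1]%O.

Let r_lt (i : 'I_(n * m)) : (i %% m < m)%N. Proof. by rewrite ltn_pmod. Qed.

Let iE (i : 'I_(n * m)) : (i = copy_of i * m + i %% m :> nat)%N.
Proof. exact: divn_eq. Qed.

Lemma arc_closed i : closed (arc i).
Proof.
apply: compact_closed; first exact: circle_hausdorff.
apply: continuous_compact; first exact/continuous_subspaceT/pt_continuous.
apply: (subclosed_compact _ (order_compact cL dL)) => //.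
rewrite (_ : [set x | _] = `[s (i %% m)%N, s (i %% m)%N.+1]%classic); first exact: itv_closed.
by apply/seteqP; split=> x /=; rewrite in_itv.
Qed.

Lemma arc_cover z : exists i, arc i z.
Proof.
have [q [x ->]] := ptP z.
have [r rm xr] : exists2 r, (r < m)%N & (s r <= x <= s r.+1)%O.
  have ex : exists j, (x <= s j)%O by exists m; rewrite sm.
  case: (ex_minnP ex) => -[|j] xj minj.
    exists 0%N => //; rewrite s0 botP (le_trans xj)//; exact/ltW/sS.
  have jm : (j < m)%N by apply: minj; rewrite sm.
  by exists j => //; rewrite xj andbT leNgt; apply/negP => /ltW/minj; rewrite ltnn.
have iP : (q * m + r < n * m)%N.
  have : (q.+1 * m <= n * m)%N by rewrite leq_mul2r ltn_ord orbT.
  by apply: leq_trans; rewrite mulSn addnC ltn_add2r.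
exists (Ordinal iP), x; first by rewrite /= modnMDl modn_small.
by congr pt; apply: val_inj; rewrite /= divnMDl// divn_small// addn0.
Qed.

Let arc_left i : arc i (pt (copy_of i) (s (i %% m)%N)).
Proof. by exists (s (i %% m)%N) => //=; rewrite lexx ltW// sS. Qed.

Let arc_right i : arc i (pt (copy_of i) (s (i %% m)%N.+1)).
Proof. by exists (s (i %% m)%N.+1) => //=; rewrite lexx andbT ltW// sS. Qed.

Lemma arc_next (i j : 'I_(n * m)) : i.+1 = j %[mod n * m] -> arc i `&` arc j !=set0.
Proof.
rewrite [RHS]modn_small// => ij.
have := r_lt i; rewrite leq_eqVlt => /predU1P[e|lt].
  have iS : (i.+1 = (copy_of i).+1 * m)%N by rewrite {1}iE -addnS e mulSn addnC.
  have jE : (j = ordS (copy_of i) * m :> nat)%N by rewrite -ij iS -muln_modl.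
  exists (pt (copy_of i) top); split.
    by have := arc_right i; rewrite e sm.
  rewrite pt_glue; have := arc_left j.
  rewrite jE modnMl s0.
  by have -> // : copy_of j = ordS (copy_of i) by apply: val_inj; rewrite /= {1}jE mulnK.
have iS : (i.+1 = copy_of i * m + (i %% m).+1)%N by rewrite {1}iE addnS.
have iN : (i.+1 < n * m)%N.
  rewrite iS; have : ((copy_of i).+1 * m <= n * m)%N by rewrite leq_mul2r ltn_ord orbT.
  by apply: leq_trans; rewrite mulSn addnC ltn_add2r.
have jE : (j = copy_of i * m + (i %% m).+1 :> nat)%N by rewrite -ij modn_small.
exists (pt (copy_of i) (s (i %% m)%N.+1)); split; first exact: arc_right.
have := arc_left j; rewrite jE modnMDl (modn_small lt).
have -> // : copy_of j = copy_of i.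
by apply: val_inj; rewrite /= {1}jE divnMDl// (divn_small lt) addn0.
Qed.

Let arc_end (i : 'I_(n * m)) x k : (s (i %% m)%N <= x <= s (i %% m)%N.+1)%O ->
  end_of (copy_of i) x = Some k ->
  i = k * m %[mod n * m] \/ i.+1 = k * m %[mod n * m].
Proof.
move=> /andP[x1 x2] /end_ofP[[xb ->]|[xt ->]].
  left; congr (_ %% _)%N; rewrite {1}iE.
  case: (posnP (i %% m)) => [->|r0]; first by rewrite addn0.
  have := s_lt r0 (ltnW (r_lt i)); rewrite s0 => /lt_le_trans/(_ x1).
  by rewrite xb ltxx.
right; have rE : (i %% m).+1 = m.
  apply/eqP; rewrite eqn_leq r_lt leqNgt; apply/negP => lt.
  have := s_lt lt (leqnn m); rewrite sm => /(le_lt_trans x2).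
  by rewrite xt ltxx.
by rewrite {1}iE -addnS rE /= addnC -mulSn muln_modl modn_mod.
Qed.

(** A common point lies in one copy, where only consecutive segments meet, or it
    is an end point.  By [arc_end], the end point of index [k] is only reached
    from the indices [k * m] and [k * m - 1] modulo [n * m]. *)
Lemma arc_meet (i j : 'I_(n * m)) : arc i `&` arc j !=set0 ->
  [\/ i = j %[mod n * m], i = j.+1 %[mod n * m] | i.+1 = j %[mod n * m]].
Proof.
case=> z [[x xi xz] [y yj yz]].
have /pt_eqP[[qE xy]|[k ik jk]] : pt (copy_of i) x = pt (copy_of j) y by rewrite xz yz.
  move: xi yj => /= /andP[x1 x2]; rewrite -xy => /andP[y1 y2].
  have rij : (i %% m <= (j %% m).+1)%N.
    rewrite leqNgt; apply/negP => lt.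
    have := s_lt lt (ltnW (r_lt i)) => /(le_lt_trans y2)/lt_le_trans/(_ x1).
    by rewrite ltxx.
  have rji : (j %% m <= (i %% m).+1)%N.
    rewrite leqNgt; apply/negP => lt.
    have := s_lt lt (ltnW (r_lt j)) => /(le_lt_trans x2)/lt_le_trans/(_ y1).
    by rewrite ltxx.
  have [iE' jE'] := (iE i, iE j); rewrite -qE in jE'.
  have : [\/ i = j :> nat, i = j.+1 :> nat | i.+1 = j :> nat].
    have [lt|lt|e] := ltngtP (i %% m)%N (j %% m)%N.
    - have e : (j %% m = (i %% m).+1)%N by apply/eqP; rewrite eqn_leq rji.
      by apply: Or33; rewrite iE' jE' e addnS.
    - have e : (i %% m = (j %% m).+1)%N by apply/eqP; rewrite eqn_leq rij.
      by apply: Or32; rewrite iE' jE' e addnS.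
    - by apply: Or31; rewrite iE' jE' e.
  by case=> e; [apply: Or31|apply: Or32|apply: Or33]; rewrite e.
have := arc_end yj jk; have := arc_end xi ik.
case=> ik' [jk'|jk'].
- by apply: Or31; rewrite ik' jk'.
- by apply: Or32; rewrite ik' jk'.
- by apply: Or33; rewrite ik' jk'.
- apply: Or31; apply/eqP; rewrite -(eqn_modDr 1) !addn1; apply/eqP.
  by rewrite ik' jk'.
Qed.

End ClosedChain.

(** The subdivision is fine enough for all the copies at once, because small sets
    are those whose images in each of the finitely many copies lie in members of
    the cover. *)
Lemma closed_circular_chain n (C : set (set (circle L n))) : (0 < n)%N -> open_cover C ->
  exists t (K : 'I_t -> set (circle L n)), [/\ (0 < t)%N, forall i, closed (K i),
    forall z, exists i, K i z, forall i, exists2 A, C A & K i `<=` A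
    & circular_chain K].
Proof.
move=> n0 [oC cC].
pose G := [set A : set L | forall i : 'I_n, exists2 V, C V & A `<=` pt i @^-1` V].
have [||m [s [s0 sm sG]]] := fine_subdivision cL dL (G := G) botP topP.
- by move=> A B GB AB i; have [V CV BV] := GB i; exists V => //; exact: subset_trans BV.
- move=> x.
  have /choice[V VP] : forall i : 'I_n, exists V, C V /\ V (pt i x).
    move=> i; have : setT (pt i x) by []. rewrite -cC => -[V CV Vx]; by exists V.
  exists [set y | forall i, V i (pt i y)].
    apply: filter_forall => i; apply: pt_continuous.
    by apply: open_nbhs_nbhs; split; [apply: oC|]; case: (VP i).
  by move=> i; exists (V i); [case: (VP i)|move=> y /(_ i)].
have sS j : (j < m)%N -> (s j < s j.+1)%O by move=> /sG[].
have m0 : (0 < m)%N by rewrite lt0n; apply/eqP => e; move: bot_top; rewrite -s0 -sm e eqxx.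
exists (n * m)%N, (arc s m0); split.
- by rewrite muln_gt0 n0.
- exact: arc_closed.
- exact: arc_cover.
- move=> i; have [|_ /(_ (copy_of m0 i))[V CV sV]] := sG (i %% m)%N; first by rewrite ltn_pmod.
  by exists V => // _ [x xi <-]; exact: sV.
- move=> i j; split; first exact: arc_meet.
  case=> e.
  + have -> : i = j by apply: val_inj; move: e; rewrite !modn_small.
    rewrite setIid; exists (pt (copy_of m0 j) (s (j %% m)%N)).
    by exists (s (j %% m)%N) => //=; rewrite lexx ltW// sS// ltn_pmod.
  + by rewrite setIC; apply: arc_next.
  + exact: arc_next.
Qed.

(** * Moving a point to infinity *)

Hypothesis reversible_left : forall a : L, bot != a -> exists r : L -> L,
  (forall x, (x <= a)%O -> (r x <= a)%O /\ r (r x) = x) /\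
  (forall x y, (x < y)%O -> (y <= a)%O -> (r y < r x)%O).
Hypothesis reversible_right : forall a : L, a != top -> exists r : L -> L,
  (forall x, (a <= x)%O -> (a <= r x)%O /\ r (r x) = x) /\
  (forall x y, (x < y)%O -> (a <= x)%O -> (r y < r x)%O).

(** An end point only needs a rotation; at an interior point [a] of its copy, the
    reflection at [a] comes first. *)
Lemma move_to_base n (v : circle L n) (k : 'I_n) : k = 0%N :> nat ->
  exists2 h, tower_symmetry h & h n v = pt k bot.
Proof.
move=> k0.
suff [h hs [j hj]] : exists2 h, tower_symmetry h & exists j, h n v = pt j bot.
  exists (fun N => iter (n - j) (@shift N) \o h N).
    exact/(tower_symmetry_comp _ hs)/tower_symmetry_shift.
  rewrite /= hj iter_shift_pt; congr pt; apply: val_inj.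
  by rewrite val_iter_ordS subnKC ?modnn ?k0// ltnW.
have [i [a ->]] := ptP v.
have [->|ba] := eqVneq bot a; first by exists (fun n => id); [exact: tower_symmetry_id|exists i].
have [->|at_] := eqVneq a top.
  by exists (fun n => id); [exact: tower_symmetry_id|exists (ordS i); exact: pt_glue].
have [l [lI lm]] := reversible_left ba; have [r [rI rm]] := reversible_right at_.
exists (@reflection a l r); first exact: tower_symmetry_reflection.
by exists (ordS (rev_ord i)); exact: reflection_center.
Qed.

(** * Inverse limits of circles *)

Section Solenoid.
Variables (p : nat -> nat) (p_gt1 : forall n, (1 < p n)%N).
Local Notation k := (winding p).
Local Notation S := (solenoid L p).

Lemma winding_gt0 n : (0 < k n)%N.
Proof. by elim: n => // n IH; rewrite /= muln_gt0 IH (ltnW (p_gt1 n)). Qed.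

Definition coord n (z : S) : circle L (k n) := set_val z n.

Lemma coordP n z : @covering_map d L (p n) (k n) (coord n.+1 z) = coord n z.
Proof. exact: (set_valP z n). Qed.

Lemma coord_ext (x y : S) : (forall n, coord n x = coord n y) -> x = y.
Proof.
by move=> xy; apply: val_inj; apply: functional_extensionality_dep => n; exact: xy.
Qed.

Lemma coord_mono m n (x y : S) : (m <= n)%N -> coord n x = coord n y -> coord m x = coord m y.
Proof.
move=> mn; rewrite -(subnK mn); elim: (n - m)%N => [//|j IH].
by rewrite addSn => e; apply: IH; rewrite -(coordP (j + m) x) -(coordP (j + m) y) e.
Qed.

Lemma mk_solenoid (z : forall n, circle L (k n)) :
  (forall n, @covering_map d L (p n) (k n) (z n.+1) = z n) ->
  exists x : S, forall n, coord n x = z n.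
Proof. by move=> zP; exists (exist _ z (mem_set zP)). Qed.

Lemma coord_continuous n : continuous (@coord n).
Proof.
move=> z; apply: (@continuous_comp _ _ _ (set_val : S -> circle_product L p) (fun f => f n)).
  exact: initial_continuous.
exact: (@proj_continuous _ (fun n => circle L (k n)) n).
Qed.

Lemma cvg_solenoid (F : set_system S) (x : S) : Filter F ->
  (forall n U, nbhs (coord n x) U -> F (coord n @^-1` U)) -> F --> x.
Proof.
move=> FF Fc.
apply: cvg_initial.
apply/(@cvg_sup _ _ _ _ (set_val x)) => n.
apply: cvg_initial => U /= nU; exact: Fc.
Qed.

Lemma solenoid_continuous (T : topologicalType) (f : T -> S) :
  (forall n, continuous (coord n \o f)) -> continuous f.
Proof.
move=> fc x; apply: cvg_solenoid => n U nU; exact: (fc n x U nU).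
Qed.

(** Preimages of neighbourhoods of a single coordinate suffice, since a condition
    on the m-th coordinate is also one on any later coordinate. *)
Lemma solenoid_nbhs (x : S) A : nbhs x A ->
  exists n U, nbhs (coord n x) U /\ forall y, U (coord n y) -> A y.
Proof.
pose F := [set A : set S | exists n U, nbhs (coord n x) U /\ forall y, U (coord n y) -> A y].
suff FF : Filter F.
  by apply: (@cvg_solenoid F x FF) => n U nU; exists n, U.
have lift m n U : (m <= n)%N -> nbhs (coord m x) U ->
    exists V, nbhs (coord n x) V /\ forall y, V (coord n y) -> U (coord m y).
  move=> mn nU; rewrite -(subnK mn); elim: (n - m)%N => [|j [V [nV VU]]].
    by exists U.
  exists (@covering_map d L (p (j + m)) (k (j + m)) @^-1` V); split.
    by apply: covering_continuous; rewrite coordP.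
  by move=> y /=; rewrite coordP => /VU.
split.
- by exists 0%N, setT; split=> //; exact: filterT.
- move=> B C [n [U [nU UB]]] [m [V [nV VC]]].
  have [U' [nU' UU]] := lift _ _ _ (leq_maxl n m) nU.
  have [V' [nV' VV]] := lift _ _ _ (leq_maxr n m) nV.
  exists (maxn n m), (U' `&` V'); split; first exact: filterI.
  by move=> y [/UU/UB ? /VV/VC].
- move=> B C BC [n [U [nU UB]]]; exists n, U; split=> // y /UB; exact: BC.
Qed.

Lemma solenoid_hausdorff : hausdorff_space S.
Proof.
move=> x y xy; apply: coord_ext => n; apply: (@circle_hausdorff (k n)) => A B nA nB.
have [z [zA zB]] := xy _ _ (coord_continuous nA) (coord_continuous nB).
by exists (coord n z).
Qed.

Lemma solenoid_compact : compact [set: S].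
Proof.
pose A := [set z : circle_product L p |
  forall n, @covering_map d L (p n) (k n) (z n.+1) = z n].
have cP : compact [set: circle_product L p].
  have := @tychonoff nat (fun n => circle L (k n)) (fun=> setT) (fun n => @circle_compact (k n)).
  by congr compact; apply/funext => z; apply/propext; split.
have pc n : continuous (fun z : circle_product L p => z n).
  exact: (@proj_continuous _ (fun n => circle L (k n)) n).
have cA : closed A.
  move=> z zA n; apply: (@circle_hausdorff (k n)) => U V nU nV.
  have n1 : nbhs z [set w : circle_product L p | U (@covering_map d L (p n) (k n) (w n.+1))].
    exact: (@continuous_comp _ _ _ (fun z : circle_product L p => z n.+1) _ z (@pc n.+1 z)
      (@covering_continuous (p n) (k n) _) U nU).
  have n2 : nbhs z [set w : circle_product L p | V (w n)] by exact: (pc n z).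
  have [w [wA [w1 w2]]] := zA _ (filterI n1 n2).
  by exists (w n); split=> //; rewrite -wA.
move=> F PF _.
have [z [Az zF]] := subclosed_compact cA cP (@subsetT _ _)
  (fmap_proper_filter (set_val : S -> circle_product L p) PF)
  (filterS (fun (x : S) _ => set_valP x) filterT).
exists (exist _ z (mem_set Az)); split=> // B C FB.
rewrite (@nbhsE S) => -[V [[W oW <-] Wz] VC].
have [|w [[x Bx xw] Ww]] := zF (set_val @` B) W _ (open_nbhs_nbhs (conj oW Wz)).
  by apply: (@filterS _ F _ B _ _ FB) => x Bx; exists x.
by exists x; split=> //; apply: VC; rewrite /= xw.
Qed.

Lemma thread_subproof n c : (c %% k n < k n)%N.
Proof. by rewrite ltn_pmod// winding_gt0. Qed.

(** The coordinates of index [c] modulo the number of copies are coherent, so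
    every point of [L] spans a thread through the copies of these indices. *)
Definition thread_index n c : 'I_(k n) := Ordinal (thread_subproof n c).

Lemma thread c a : exists x : S, forall n, coord n x = pt (thread_index n c) a.
Proof.
apply: mk_solenoid => n; rewrite covering_pt; congr pt; apply: val_inj => /=.
by rewrite modn_dvdm// dvdn_mull.
Qed.

Lemma coord_surjective n (z : circle L (k n)) : exists x, coord n x = z.
Proof.
have [i [a ->]] := ptP z; have [x xP] := thread i a; exists x; rewrite xP.
by congr pt; apply: val_inj; rewrite /= modn_small.
Qed.

Lemma coord_closed n (A : set S) : closed A -> closed (coord n @` A).
Proof.
move=> cA; apply: compact_closed; first exact: circle_hausdorff.
apply: continuous_compact; first exact/continuous_subspaceT/coord_continuous.
exact: subclosed_compact cA solenoid_compact _.
Qed.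

(** Otherwise, for each n some fibre of the n-th coordinate, that of [b n], is
    contained in no member.  A cluster point of [b] has a basic neighbourhood
    inside a member, given by a coordinate m; for some n beyond m it contains
    [b n] together with its whole fibre. *)
Lemma fibre_refinement (C : set (set S)) : open_cover C ->
  exists n, forall x, exists2 A, C A & forall y, coord n y = coord n x -> A y.
Proof.
move=> [oC cC]; apply: contrapT => /forallNP nex.
have /choice[b bP] : forall n, exists x, forall A, C A ->
    exists2 y, coord n y = coord n x & ~ A y.
  move=> n; have /existsNP[x xP] := nex n; exists x => A CA.
  apply: contrapT => h; apply: xP; exists A => // y e.
  by apply: contrapT => nAy; apply: h; exists y.
have [x [_ xb]] := solenoid_compact (F := b @ \oo) _ filterT.
have : setT x by []; rewrite -cC => -[A CA Ax].
have [m [U [nU UA]]] := solenoid_nbhs (open_nbhs_nbhs (conj (oC _ CA) Ax)).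
have [|z [[n mn <-] /= Uz]] := xb (b @` [set n | (m <= n)%N]) _ _ (coord_continuous nU).
  by exists m => // n /= mn; exists n.
have [y yb] := bP n A CA; apply; apply: UA.
by rewrite (coord_mono mn yb).
Qed.

Lemma solenoid_connected : connected [set: S].
Proof.
move=> B [b Bb] [U oU BU] [V cV BV]; rewrite setTI in BU; rewrite setTI in BV.
have oB : open B by rewrite BU.
have cB : closed B by rewrite BV.
have [|n nP] := @fibre_refinement [set B; ~` B].
  split=> [A [->//|->]|]; first exact: closed_openC.
  apply/seteqP; split=> // x _; have [Bx|nBx] := pselect (B x).
    by exists B => //; left.
  by exists (~` B) => //; right.
(* The clopen set is saturated at level [n], so its image is clopen. *)
have fib x y : coord n x = coord n y -> B x -> B y.
  move=> e Bx; have [A [->|->] AP] := nP x; first exact: AP.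
  by case: (AP x erefl Bx).
have ne : coord n @` B = ~` (coord n @` (~` B)).
  apply/seteqP; split=> [_ [x Bx <-] [y nBy e]|w nw]; first exact/nBy/(fib x).
  have [x xw] := coord_surjective w; exists x => //.
  by apply: contrapT => nBx; apply: nw; exists x.
have BE : coord n @` B = setT.
  apply: circle_connected; first by exists (coord n b); exists b.
    exists (coord n @` B); rewrite ?setTI// ne.
    exact/closed_openC/coord_closed/open_closedC.
  by exists (coord n @` B); rewrite ?setTI//; exact: coord_closed.
apply/seteqP; split=> // x _.
have : setT (coord n x) by []; rewrite -BE => -[y By e]; exact: fib By.
Qed.

Lemma solenoid_continuum : continuum S.
Proof. by split; [exact: solenoid_compact|exact: solenoid_connected|exact: solenoid_hausdorff]. Qed.

Lemma solenoid_circle_like : circle_like S.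
Proof.
move=> C coverC; have [oC cC] := coverC; have [n nP] := fibre_refinement coverC.
pose D := [set V : set (circle L (k n)) | open V /\
  exists2 A, C A & forall y, V (coord n y) -> A y].
have cD : open_cover D.
  split=> [V []//|]; apply/seteqP; split=> // z _.
  have [x xz] := coord_surjective z; have [A CA AP] := nP x.
  exists (~` (coord n @` (~` A))); last by move=> [y nAy e]; apply/nAy/AP; rewrite e.
  split; first exact/closed_openC/coord_closed/open_closedC/oC.
  exists A => // y h; apply: contrapT => nAy; apply: h; by exists y.
have [t [K [t0 cK Kcov KD Kchain]]] := closed_circular_chain (winding_gt0 n) cD.
have /choice[A AP] : forall i, exists A, C A /\ coord n @^-1` K i `<=` A.
  move=> i; have [V [_ [A CA VA]] KV] := KD i; exists A; split=> // y /KV; exact: VA.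
have [|||U [oU KU UA Udisj]] := @swelling _ t (fun i => coord n @^-1` K i) A
  solenoid_hausdorff solenoid_compact.
- by move=> i; move/continuous_closedP: (@coord_continuous n); apply.
- by move=> i; apply: oC; case: (AP i).
- by move=> i; case: (AP i).
exists t, U; split=> //.
- split=> [_ [i _ <-]//|]; apply/seteqP; split=> // x _.
  have [i Ki] := Kcov (coord n x); exists (U i); first by exists i.
  exact: KU.
- by move=> i; exists (A i); [case: (AP i)|exact: UA].
- move=> i j; rewrite -Kchain; split=> [|[z [Ki Kj]]].
    move=> Uij; apply: contrapT => nK.
    have : U i `&` U j = set0.
      apply: Udisj; apply/seteqP; split=> x //= [xi xj].
      by apply: nK; exists (coord n x).
    by case: Uij => x Ux e; rewrite e in Ux.
  by have [x xz] := coord_surjective z; exists x; split; apply: KU; rewrite /= xz.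
Qed.

(** At the level [N] the images of [A] and [B] omit the coordinates of [x] and [y].
    A tower symmetry moves the latter to the end point of index 0, where the
    sheets are available; [z1] and [z2] are two points over the former. *)
Lemma solenoid_indecomposable : indecomposable S.
Proof.
move=> [A [B [[[_ cA conA] AT] [[_ cB conB] BT] AB]]].
have miss (D : set S) : compact D -> D != setT ->
    exists x n, forall y, D y -> coord n y <> coord n x.
  move=> cD DT; have [x nDx] : exists x, ~ D x.
    apply: contrapT => h; move/eqP: DT; apply; apply/seteqP; split=> // x _.
    by apply: contrapT => nDx; apply: h; exists x.
  have oD : open (~` D) by exact: closed_openC (compact_closed solenoid_hausdorff cD).
  have [n [U [nU UD]]] := solenoid_nbhs (open_nbhs_nbhs (conj oD nDx)).
  exists x, n => y Dy e; apply: (UD y) => //; rewrite e; exact: nbhs_singleton.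
have [x [na xA]] := miss A cA AT; have [y [nb yB]] := miss B cB BT.
pose N := maxn na nb.
have xA' w : A w -> coord N w <> coord N x.
  by move=> Aw e; apply: (xA w Aw); exact: coord_mono (leq_maxl _ _) e.
have yB' w : B w -> coord N w <> coord N y.
  by move=> Bw e; apply: (yB w Bw); exact: coord_mono (leq_maxr _ _) e.
pose o : circle L (k N) := pt (Ordinal (winding_gt0 N)) bot.
have [h [g [hP hc]] hy] : exists2 h, @tower_symmetry h & h (k N) (coord N y) = o.
  exact: move_to_base.
have [i [a xE]] := ptP (coord N x).
pose pr := @covering_map d L (p N) (k N).
have i1P : (i < p N * k N)%N.
  by rewrite (leq_trans (ltn_ord i))// leq_pmull// (ltnW (p_gt1 N)).
have i2P : (i + k N < p N * k N)%N.
  have : (2 * k N <= p N * k N)%N by rewrite leq_mul2r p_gt1 orbT.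
  by apply: leq_trans; rewrite mul2n -addnn ltn_add2r.
pose z1 : circle L (k N.+1) := pt (Ordinal i1P) a.
pose z2 : circle L (k N.+1) := pt (Ordinal i2P) a.
have pz1 : pr z1 = coord N x.
  by rewrite /pr covering_pt xE; congr pt; apply: val_inj; rewrite /= modn_small.
have pz2 : pr z2 = coord N x.
  by rewrite /pr covering_pt xE; congr pt; apply: val_inj; rewrite /= modnDr modn_small.
have z12 : z1 <> z2.
  move=> /(pt_same) e; have /= := congr1 val e; move=> e'.
  by have := winding_gt0 N; move: e'; rewrite -[LHS]addn0 => /addnI <-.
have inB (z : circle L (k N.+1)) : pr z = coord N x -> (coord N.+1 @` B) z.
  move=> zx; have [w wz] := @coord_surjective N.+1 z; exists w => //.
  have : (A `|` B) w by rewrite AB.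
  by case=> // Aw; exfalso; apply: (xA' w Aw); rewrite -coordP wz.
pose hB := h (k N.+1) @` (coord N.+1 @` B).
have conhB : connected hB.
  apply: connected_continuous_connected; last first.
    by apply: continuous_subspaceT; case: (hP (k N.+1)).
  apply: connected_continuous_connected => //.
  exact/continuous_subspaceT/coord_continuous.
have hBo z : hB z -> pr z <> o.
  move=> [_ [w Bw <-] <-]; rewrite /pr (hc (p N) (k N)) coordP -hy => e.
  case: (hP (k N)) => _ _ hK _; apply: (yB' w Bw); exact: (can_inj hK).
apply: z12; case: (hP (k N.+1)) => _ _ hK _; apply: (can_inj hK).
apply: (@covering_injective_of_connected (p N) (k N) (Ordinal (winding_gt0 N)) hB) => //.
- by exists z1 => //; exact: inB.
- by exists z2 => //; exact: inB.
- by rewrite !(hc (p N) (k N)) -/(pr z1) -/(pr z2) pz1 pz2.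
Qed.

Lemma levelwise_homeomorphism (h g : forall n, circle L (k n) -> circle L (k n)) :
  (forall n, [/\ continuous (h n), continuous (g n), cancel (h n) (g n) & cancel (g n) (h n)]) ->
  (forall n z, @covering_map d L (p n) (k n) (h n.+1 z) = h n (@covering_map d L (p n) (k n) z)) ->
  exists2 H : S -> S, homeomorphism H & forall n x, coord n (H x) = h n (coord n x).
Proof.
move=> hgP hc.
have gc n z : @covering_map d L (p n) (k n) (g n.+1 z) = g n (@covering_map d L (p n) (k n) z).
  have [_ _ hK _] := hgP n; have [_ _ _ gK'] := hgP n.+1.
  by rewrite -[LHS]hK -hc gK'.
have /choice[H HP] : forall x : S, exists y : S, forall n, coord n y = h n (coord n x).
  by move=> x; apply: mk_solenoid => n; rewrite hc coordP.
have /choice[G GP] : forall x : S, exists y : S, forall n, coord n y = g n (coord n x).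
  by move=> x; apply: mk_solenoid => n; rewrite gc coordP.
exists H => //; split.
  apply: solenoid_continuous => n.
  rewrite (_ : _ \o _ = h n \o coord n); last by apply/funext => x; exact: HP.
  move=> x; apply: continuous_comp; first exact: coord_continuous.
  by have [hn _ _ _] := hgP n; exact: hn.
exists G; split.
- apply: solenoid_continuous => n.
  rewrite (_ : _ \o _ = g n \o coord n); last by apply/funext => x; exact: GP.
  move=> x; apply: continuous_comp; first exact: coord_continuous.
  by have [_ gn _ _] := hgP n; exact: gn.
- by move=> x; apply: coord_ext => n; rewrite GP HP; case: (hgP n).
- by move=> x; apply: coord_ext => n; rewrite HP GP; case: (hgP n).
Qed.

(** The n-th coordinate of [x] is an end point, of index [e n] say, and coherence
    gives [e n.+1 = e n] modulo the number of copies.  The rotations by [e n]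
    copies therefore commute with the bonding maps. *)
Lemma translate_to_base (x o : S) : (forall n, coord n o = pt (thread_index n 0) bot) ->
  (exists i : 'I_(k 0), coord 0 x = pt i bot) ->
  exists2 H : S -> S, homeomorphism H & H o = x.
Proof.
move=> oP [i0 x0].
have /choice[e eP] : forall n, exists c, coord n x = iter c (@shift (k n)) (coord n o).
  have xn n : exists i : 'I_(k n), coord n x = pt i bot.
    elim: n => [|n [i ix]]; first by exists i0.
    have [j [a xj]] := ptP (coord n.+1 x).
    have : pt (mod_ord (m := p n) (n := k n) j) a = pt i bot.
      by rewrite -covering_pt -ix -coordP xj.
    move=> /pt_eqP[[_ aE]|[l /end_ofP[[aE _]|[aE _]] _]].
    - by exists j; rewrite xj aE.
    - by exists j; rewrite xj aE.
    - by exists (ordS j); rewrite xj aE; exact: (pt_glue j).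
  move=> n; have [i ix] := xn n; exists (i : nat).
  rewrite ix oP iter_shift_pt; congr pt; apply: val_inj.
  by rewrite val_iter_ordS /= mod0n add0n modn_small.
have cov_iter m n c (z : circle L (m * n)) :
    covering_map (iter c (@shift (m * n)%N) z) = iter c (@shift n) (covering_map z).
  by elim: c => // c IH; rewrite !iterS covering_shift IH.
have eS n : e n.+1 = e n %[mod k n].
  have := coordP n x; rewrite !eP (cov_iter (p n) (k n)) coordP.
  rewrite oP !iter_shift_pt => /pt_same/(congr1 val).
  by rewrite !val_iter_ordS /= mod0n !add0n.
have [|n z|H Hh HP] := @levelwise_homeomorphism (fun n => iter (e n) (@shift (k n)))
  (fun n => iter (e n) (@unshift (k n))).
- have iterK (T : Type) (f g : T -> T) c : cancel f g -> cancel (iter c f) (iter c g).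
    by move=> fK; elim: c => // c IH z; rewrite iterSr (iterS _ f) fK IH.
  have iter_cont (T : topologicalType) (f : T -> T) c : continuous f -> continuous (iter c f).
    move=> fc; elim: c => [|c IH] z; first exact: cvg_id.
    by apply: (@continuous_comp _ _ _ (iter c f) f); [exact: IH|exact: fc].
  move=> n; split.
  + exact/iter_cont/shift_continuous.
  + exact/iter_cont/unshift_continuous.
  + exact/iterK/shiftK.
  + exact/iterK/unshiftK.
- rewrite (cov_iter (p n) (k n)); exact: iter_shift_mod.
- by exists H => //; apply: coord_ext => n; rewrite HP -eP.
Qed.

(** A tower symmetry moves the first coordinate of [x] to infinity; the remaining
    coordinates then lie over infinity and a translation applies. *)
Lemma solenoid_homogeneous : homogeneous S.
Proof.
have [o oP] := thread 0 bot.
have from_base x : exists2 H : S -> S, homeomorphism H & H o = x.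
  have [h [g [hP hc]] hx] : exists2 h, @tower_symmetry h &
      h (k 0) (coord 0 x) = pt (thread_index 0 0) bot by exact: move_to_base.
  have [|n z|H Hh HP] := @levelwise_homeomorphism (fun n => h (k n)) (fun n => g (k n)).
  - by move=> n; exact: hP.
  - exact: (hc (p n) (k n)).
  have [|G Gh Go] := translate_to_base oP (x := H x).
    by exists (thread_index 0 0); rewrite HP.
  have [K Kh KH] := homeomorphism_inv Hh (erefl (H x)).
  by exists (K \o G); [exact: homeomorphism_comp|rewrite /= Go].
move=> x y; have [G Gh Go] := from_base x; have [H Hh Ho] := from_base y.
have [K Kh KH] := homeomorphism_inv Gh Go.
by exists (H \o K); [exact: homeomorphism_comp|rewrite /= KH].
Qed.

(** Disjoint open sets of [L] that avoid the end points are open in the circle of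
    level 0, and their preimages are disjoint open sets of the inverse limit. *)
Lemma solenoid_not_metrizable (I : Type) (G : I -> set L) : (forall i, open (G i)) ->
  (forall i, G i !=set0) -> (forall i, ~ G i bot) -> (forall i, ~ G i top) ->
  (forall i j x, G i x -> G j x -> i = j) -> ~ countable [set: I] -> ~ metrizable S.
Proof.
move=> oG neG Gbot Gtop dG; apply: contra_not => mS.
have G_end r (i : 'I_(k 0)) l x : end_of i x = Some l -> ~ G r x.
  by move=> /end_ofP[[-> _]|[-> _]]; [exact: Gbot|exact: Gtop].
pose U r := [set w : circle L (k 0) | exists i x, w = pt i x /\ G r x].
have UE r (i : 'I_(k 0)) x : U r (pt i x) -> G r x.
  by move=> [j [y [/pt_eqP[[_ ->]//|[l _ /G_end h]] /h]]].
apply: (@metrizable_countable_cellularity S I (fun r => coord 0 @^-1` U r)) => //.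
- exact: solenoid_compact.
- move=> r; apply: open_comp; first by move=> x _; exact: coord_continuous.
  apply/circle_openP => i; rewrite (_ : [set x | _] = G r)//.
  by apply/seteqP; split=> x; [exact: UE|move=> Gx; exists i, x].
- move=> r; have [x Gx] := neG r.
  have [z zx] := coord_surjective (pt (thread_index 0 0) x).
  by exists z; exists (thread_index 0 0), x.
- move=> r s z [i [x [zx Gx]]] /= Us; apply: (dG r s x) => //.
  by apply: (UE s i); rewrite -zx.
Qed.

End Solenoid.

End Circles.

(** * The lexicographic continuum and its solenoids *)

Section LexContinuum.
Variable R : realType.
Local Notation L := (order_topology (lexseq R)).

Definition lex_block (s : unit_itv R) : set L :=
  [set x | (lex_cons s (lex_bot R) < x < lex_cons s (lex_top R))%O].

Lemma lex_block_head s x : lex_block s x -> x O = s.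
Proof.
rewrite /lex_block /= -{1 2}(lex_consK x).
move=> /andP[/ltW/lex_cons_le_head h1 /ltW/lex_cons_le_head h2].
by apply/eqP; rewrite eq_le h1 h2.
Qed.

Lemma lex_block_open s : open (lex_block s).
Proof.
rewrite (_ : lex_block s = `]lex_cons s (lex_bot R), lex_cons s (lex_top R)[%classic).
  exact: itv_open.
by apply/seteqP; split=> x /=; rewrite in_itv.
Qed.

Lemma lex_block_nonempty s : lex_block s !=set0.
Proof.
have [|x h1 h2] := @lex_dense R (lex_cons s (lex_bot R)) (lex_cons s (lex_top R)).
  by apply/lex_ltP; exists 1%N; [case|exact: zeroI_lt_oneI].
by exists x; rewrite /lex_block /= h1 h2.
Qed.

End LexContinuum.

Theorem mainTheorem4 :
  exists (d : Order.disp_t) (L : orderTopologicalType d),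
    ordered_continuum L /\
    forall p : nat -> nat, (forall n : nat, (1 < p n)%N) ->
      [/\ continuum (solenoid L p),
          ~ metrizable (solenoid L p),
          homogeneous (solenoid L p),
          indecomposable (solenoid L p)
        & circle_like (solenoid L p)].
Proof.
pose R : realType := Rdefinitions.R.
pose L : orderTopologicalType _ := order_topology (lexseq R).
have cL : complete_order L := @lex_sup R.
have dL : dense_order L := @lex_dense R.
pose bot : L := lex_bot R; pose top : L := lex_top R.
have botP (x : L) : (bot <= x)%O := lex_ge0 x.
have topP (x : L) : (x <= top)%O := lex_le1 x.
have lt_bot_top : (bot < top)%O by apply/lex_ltP; exists O => //; exact: zeroI_lt_oneI.
have bot_top : bot != top by rewrite lt_eqF.
have left (a : L) : bot != a -> exists r : L -> L,
    (forall x, (x <= a)%O -> (r x <= a)%O /\ r (r x) = x) /\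
    (forall x y, (x < y)%O -> (y <= a)%O -> (r y < r x)%O).
  by move=> ba; apply: left_reversal; rewrite eq_sym.
have right (a : L) : a != top -> exists r : L -> L,
    (forall x, (a <= x)%O -> (a <= r x)%O /\ r (r x) = x) /\
    (forall x y, (x < y)%O -> (a <= x)%O -> (r y < r x)%O).
  exact: right_reversal.
exists _, L; split.
  by split; [exists bot, top|exact: order_compact|exact: order_connected].
move=> p p1; split.
- exact: (solenoid_continuum botP topP).
- apply: (solenoid_not_metrizable botP topP cL dL p1 (G := @lex_block R)).
  + exact: lex_block_open.
  + exact: lex_block_nonempty.
  + by move=> s /andP[]; rewrite ltNge botP.
  + by move=> s /andP[_]; rewrite ltNge topP.
  + by move=> s t x /lex_block_head <- /lex_block_head.
  + apply: complete_dense_uncountable; [exact: unitI_sup|exact: unitI_dense|].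
    by exists (zeroI R), (oneI R); exact: zeroI_lt_oneI.
- exact: (solenoid_homogeneous botP topP bot_top).
- exact: (solenoid_indecomposable botP topP bot_top).
- exact: (solenoid_circle_like botP topP bot_top).
Qed.
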